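(* Let $G$ be a second-countable locally compact group, let $N$ be a closed normal subgroup of $G$, and let $\mathcal{H}$ be a separable Hilbert space. Suppose $\pi:N\to U(\mathcal{H})$ is a unitary representation of $N$ which is $G$-invariant. Then there is a twisted action $(\alpha,\sigma)$ of $G/N$ on the commutant $\pi(N)'$ of $\pi(N)$ such that $\pi$ extends to a unitary representation $\rho$ of $G$ on $\mathcal{H}$ (that is, $\rho:G\to U(\mathcal{H})$ with $\rho|_N=\pi$) if and only if $(\alpha,\sigma)$ is exterior equivalent to an action.
   Context: $U(\mathcal{H})$ is the group of all unitary operators on $\mathcal{H}$ with the strong operator topology. A unitary representation of a locally compact group is a continuous homomorphism into $U(\mathcal{H})$; it need not be irreducible. A unitary representation $\pi$ of $N$ on $\mathcal{H}$ is $G$-invariant if, for each $s\in G$, $\pi$ is unitarily equivalent to the representation $\pi^s:n\mapsto \pi(sns^{-1})$. The commutant $\pi(N)'$ is the von Neumann algebra of bounded operators on $\mathcal{H}$ which commute with every $\pi(n)$, $n\in N$. For a von Neumann algebra $\mathcal{A}$ acting on a separable Hilbert space, $U(\mathcal{A})$ is its group of unitary elements with the ultra-weak topology (which agrees on $U(\mathcal{A})$ with the strong operator topology; it is a Polish group), and $\mathrm{Aut}(\mathcal{A})$ is its group of automorphisms with the $u$-topology: $\alpha_i\to\alpha$ if and only if $\|f\circ\alpha_i-f\circ\alpha\|\to 0$ for every $f$ in the predual $\mathcal{A}_*$ (it is a Polish group). For $u\in U(\mathcal{A})$, $\mathrm{Ad}\,u$ is the automorphism $a\mapsto uau^*$.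 Let $K$ be a second-countable locally compact group with identity $e$. A twisted action of $K$ on $\mathcal{A}$ is a pair $(\alpha,\sigma)$ of maps $\alpha:K\to\mathrm{Aut}(\mathcal{A})$ and $\sigma:K\times K\to U(\mathcal{A})$ such that (1) $\alpha$ and $\sigma$ are Borel; (2) $\alpha_e=\mathrm{id}$ and $\sigma(e,s)=\sigma(s,e)=1$ for $s\in K$; (3) $\alpha_s\circ\alpha_t=\mathrm{Ad}\,\sigma(s,t)\circ\alpha_{st}$ for $s,t\in K$; (4) $\alpha_r(\sigma(s,t))\,\sigma(r,st)=\sigma(r,s)\,\sigma(rs,t)$ for $r,s,t\in K$. Two twisted actions $(\alpha,\sigma)$ and $(\beta,\omega)$ of $K$ on $\mathcal{A}$ are exterior equivalent if there is a Borel map $\nu:K\to U(\mathcal{A})$ such that, for all $s,t\in K$, $\beta_s=\mathrm{Ad}\,\nu_s\circ\alpha_s$ and $\omega(s,t)=\nu_s\,\alpha_s(\nu_t)\,\sigma(s,t)\,\nu_{st}^*$. An (ordinary) action of $K$ on $\mathcal{A}$ is a continuous homomorphism $\beta:K\to\mathrm{Aut}(\mathcal{A})$, identified with the twisted action $(\beta,1)$; ''exterior equivalent to an action'' means exterior equivalent to some such $(\beta,1)$. *)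

(* Defs.v *)
(* The complex numbers are R[i] for an arbitrary R : realType. *)
From HB Require Import structures.
From mathcomp Require Import all_boot all_order all_algebra.
From mathcomp Require Import complex.
From mathcomp Require Import all_classical all_reals all_analysis.

Set Implicit Arguments.
Unset Strict Implicit.
Unset Printing Implicit Defensive.

Import Order.TTheory GRing.Theory Num.Theory.
Import numFieldNormedType.Exports.

Local Open Scope classical_set_scope.
Local Open Scope complex_scope.
Local Open Scope ring_scope.

HB.mixin Record Group_isTopGroup G of Group G & Topological G := {
  mulg_continuous : continuous (fun p : G * G => (p.1 * p.2)%g);
  invg_continuous : continuous (fun x : G => x^-1%g)
}.

#[short(type="topGroupType")]
HB.structure Definition TopGroup :=
  {G of Group G & Topological G & Group_isTopGroup G}.

(* Measurability for the sigma-algebras generated by the open sets. *)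
Definition borel_map (X Y : topologicalType) (f : X -> Y) :=
  forall B : set Y, <<s @open Y >> B -> <<s @open X >> (f @^-1` B).

Record normalSubgroup (G : groupType) := NormalSubgroup {
  ns_set : set G;
  ns1 : ns_set 1%g;
  nsM : forall x y, ns_set x -> ns_set y -> ns_set (x * y)%g;
  nsV : forall x, ns_set x -> ns_set x^-1%g;
  nsJ : forall s n, ns_set n -> ns_set (s * n * s^-1)%g
}.

Definition ns_sort (G : groupType) (N : normalSubgroup G) : Type :=
  set_type (ns_set N).
Coercion ns_sort : normalSubgroup >-> Sortclass.

Section NormalSubgroupType.
Context (G : groupType) (N : normalSubgroup G).

HB.instance Definition _ := SubChoice.on (ns_sort N).

Fact ns_group_closed : group_closed (fun x : G => x \in ns_set N).
Proof.
split; first by rewrite inE; exact: ns1.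
by move=> x y; rewrite !inE => Nx Ny; apply: nsM => //; exact: nsV.
Qed.

HB.instance Definition _ :=
  SubChoice_isSubGroup.Build G _ (ns_sort N) ns_group_closed.

Fact ns_conj_subproof (s : G) (n : ns_sort N) :
  (s * val n * s^-1)%g \in ns_set N.
Proof. by rewrite inE; apply: nsJ; have := valP n; rewrite inE. Qed.

Definition ns_conj (s : G) (n : ns_sort N) : ns_sort N :=
  Sub (s * val n * s^-1)%g (ns_conj_subproof s n).

End NormalSubgroupType.

Section NormalSubgroupTopology.
Context (G : topGroupType) (N : normalSubgroup G).

HB.instance Definition _ :=
  Topological.copy (ns_sort N) (set_type (ns_set N)).

Let val_cont : continuous (val : ns_sort N -> G).
Proof. exact: (@initial_continuous (set_type (ns_set N)) G set_val). Qed.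

Let to_ns_cont (Z : topologicalType) (f : Z -> ns_sort N) :
  continuous (fun z => val (f z)) -> continuous f.
Proof.
move=> cf; apply/continuousP => A [B oB <-].
by move/continuousP: cf => /(_ B oB).
Qed.

Fact ns_mulg_continuous :
  continuous (fun p : ns_sort N * ns_sort N => (p.1 * p.2)%g).
Proof.
apply: to_ns_cont => p.
have -> : (fun z : ns_sort N * ns_sort N => val (z.1 * z.2)%g) =
    (fun q : G * G => (q.1 * q.2)%g) \o
    (fun z : ns_sort N * ns_sort N => (val z.1, val z.2)).
  by [].
apply: continuous_comp; last exact: mulg_continuous.
apply: cvg_pair => /=.
- by apply: continuous_comp; [exact: cvg_fst|exact: val_cont].
- by apply: continuous_comp; [exact: cvg_snd|exact: val_cont].
Qed.

Fact ns_invg_continuous : continuous (fun x : ns_sort N => x^-1%g).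
Proof.
apply: to_ns_cont => x.
have -> : (fun z : ns_sort N => val z^-1%g) = (fun y : G => y^-1%g) \o val.
  by [].
by apply: continuous_comp; [exact: val_cont|exact: invg_continuous].
Qed.

HB.instance Definition _ :=
  Group_isTopGroup.Build (ns_sort N) ns_mulg_continuous ns_invg_continuous.

End NormalSubgroupTopology.

Section QuotientGroup.
Context (G : topGroupType) (N : normalSubgroup G).
Local Open Scope quotient_scope.

Definition coset_eq (x y : G) : bool := (x^-1 * y)%g \in ns_set N.

Fact coset_eq_refl : reflexive coset_eq.
Proof. by move=> x; rewrite /coset_eq mulVg inE; exact: ns1. Qed.

Fact coset_eq_sym : symmetric coset_eq.
Proof.
move=> x y; apply/idP/idP; rewrite /coset_eq !inE => /nsV;
  by rewrite invgM invgK.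
Qed.

Fact coset_eq_trans : transitive coset_eq.
Proof.
move=> y x z; rewrite /coset_eq !inE => Nxy Nyz.
by have := nsM Nxy Nyz; rewrite mulgA -(mulgA x^-1)%g mulgV mulg1.
Qed.

Canonical coset_equiv :=
  EquivRel coset_eq coset_eq_refl coset_eq_sym coset_eq_trans.

Definition quotient_group : Type := quotient_topology {eq_quot coset_equiv}.

HB.instance Definition _ := Quotient.on quotient_group.
HB.instance Definition _ := Topological.on quotient_group.

Local Notation pi := (\pi_quotient_group : G -> quotient_group).

Let pi_eq (x y : G) : ns_set N (x^-1 * y)%g <-> pi x = pi y.
Proof.
split=> [Nxy|/eqmodP]; last by rewrite /= /coset_eq inE.
by apply/eqmodP; rewrite /= /coset_eq inE.
Qed.

Let piP (a : quotient_group) : pi (repr a) = a.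
Proof. exact: reprK. Qed.

Definition qmul (a b : quotient_group) : quotient_group :=
  pi (repr a * repr b)%g.
Definition qinv (a : quotient_group) : quotient_group := pi (repr a)^-1%g.

Fact qmulE (x y : G) : qmul (pi x) (pi y) = pi (x * y)%g.
Proof.
apply/pi_eq; rewrite invgM.
set x' := repr (pi x); set y' := repr (pi y).
have Nx : ns_set N (x'^-1 * x)%g by apply/pi_eq; rewrite piP.
have Ny : ns_set N (y'^-1 * y)%g by apply/pi_eq; rewrite piP.
have := nsM (nsJ y'^-1%g Nx) Ny.
by rewrite invgK !mulgA -(mulgA _ y' y'^-1)%g mulgV mulg1.
Qed.

Fact qinvE (x : G) : qinv (pi x) = pi x^-1%g.
Proof.
apply/pi_eq; rewrite invgK; set x' := repr _.
have Nx : ns_set N (x^-1 * x')%g by apply/pi_eq; rewrite piP.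
have := nsJ x Nx.
by rewrite mulgA mulgV mul1g.
Qed.

Fact qmulA : associative qmul.
Proof.
by move=> a b c; rewrite -[a]piP -[b]piP -[c]piP !qmulE mulgA.
Qed.
Fact qmul1 : left_id (pi 1%g) qmul.
Proof. by move=> a; rewrite -[a]piP qmulE mul1g. Qed.
Fact qmul1r : right_id (pi 1%g) qmul.
Proof. by move=> a; rewrite -[a]piP qmulE mulg1. Qed.
Fact qmulV : left_inverse (pi 1%g) qinv qmul.
Proof. by move=> a; rewrite -[a]piP qinvE qmulE mulVg. Qed.
Fact qmulVr : right_inverse (pi 1%g) qinv qmul.
Proof. by move=> a; rewrite -[a]piP qinvE qmulE mulgV. Qed.

HB.instance Definition _ :=
  isGroup.Build quotient_group qmulA qmul1 qmul1r qmulV qmulVr.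

Let pi_cont : continuous pi.
Proof. exact: (@pi_continuous G {eq_quot coset_equiv}). Qed.

Let mulgl_cont (s : G) : continuous (fun x : G => (x * s)%g).
Proof.
move=> x; apply: (@continuous_comp _ _ _ (fun x : G => (x, s))
  (fun p : G * G => (p.1 * p.2)%g)); last exact: mulg_continuous.
by apply: cvg_pair; [exact: cvg_id|exact: cvg_cst].
Qed.

Let pi_open (U : set G) : open U -> open (pi @` U).
Proof.
move=> oU.
have -> : open (pi @` U) = open (pi @^-1` (pi @` U)) by [].
have -> : pi @^-1` (pi @` U) =
    \bigcup_(n in ns_set N) (fun x : G => (x * n)%g) @^-1` U.
  apply/seteqP; split=> x /=.
    move=> [u Uu] /esym/pi_eq Nn; exists (x^-1 * u)%g => //=.
    by rewrite mulgA mulgV mul1g.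
  move=> [n Nn /= Uxn]; exists (x * n)%g => //; apply/esym/pi_eq.
  by rewrite mulgA mulVg mul1g.
by apply: bigcup_open => n _; move: (@mulgl_cont n) => /continuousP; apply.
Qed.

Fact qmul_continuous :
  continuous (fun p : quotient_group * quotient_group => (p.1 * p.2)%g).
Proof.
move=> [a b]; rewrite -[a]piP -[b]piP; set x := repr a; set y := repr b.
move=> W /=; rewrite [(pi x * pi y)%g]qmulE => nW.
have : nbhs (x, y) ((fun p : G * G => (p.1 * p.2)%g) @^-1` (pi @^-1` W)).
  by apply: mulg_continuous; exact: pi_cont.
move=> [[U V] /= [nU nV] sUV].
have [U' [oU' Ux] sU] : exists2 U', open_nbhs x U' & U' `<=` U.
  by move: nU; rewrite nbhsE.
have [V' [oV' Vy] sV] : exists2 V', open_nbhs y V' & V' `<=` V.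
  by move: nV; rewrite nbhsE.
have : nbhs (pi x, pi y) ((pi @` U') `*` (pi @` V')).
  exists (pi @` U', pi @` V') => //=; split; apply: open_nbhs_nbhs.
  - by split; [exact: pi_open|exists x].
  - by split; [exact: pi_open|exists y].
apply: filterS.
move=> [_ _] /= [[u Uu <-] [v Vv <-]].
rewrite [(_ * _)%g]qmulE; apply: (sUV (u, v)); split; [exact: sU|exact: sV].
Qed.

Fact qinv_continuous : continuous (fun a : quotient_group => a^-1%g).
Proof.
apply/(@quotient_continuous G {eq_quot coset_equiv}) => x.
have -> : (fun a : quotient_group => a^-1%g) \o \pi_{eq_quot coset_equiv} =
    pi \o (fun x : G => x^-1%g).
  by apply/funext => z /=; rewrite [LHS]qinvE.
by apply: continuous_comp; [exact: invg_continuous|exact: pi_cont].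
Qed.

HB.instance Definition _ :=
  Group_isTopGroup.Build quotient_group qmul_continuous qinv_continuous.

End QuotientGroup.

HB.mixin Record CompleteNormedModule_isHilbert (R : realType) H
    of CompleteNormedModule R[i] H := {
  hdot : {dot H for (@Num.conj R[i])};
  hdotE : forall x : H, hdot x x = `|x| ^+ 2
}.

#[short(type="hilbertType")]
HB.structure Definition Hilbert (R : realType) :=
  {H of CompleteNormedModule R[i] H & CompleteNormedModule_isHilbert R H}.

Definition separable (T : topologicalType) :=
  exists2 D : set T, countable D & dense D.

Record bop (R : realType) (H : hilbertType R) := Bop {
  bop_fun :> H -> H;
  bop_linear : linear bop_fun;
  bop_bounded : exists M : R[i], forall x, `|bop_fun x| <= M * `|x|
}.

Section BoundedOperators.
Context (R : realType) (H : hilbertType R).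
Local Notation B := (bop H).
Implicit Types S T : B.

HB.instance Definition _ := gen_eqMixin B.
HB.instance Definition _ := gen_choiceMixin B.

Lemma bopP S T : (forall x, S x = T x) -> S = T.
Proof.
case: S T => [f lf bf] [g lg bg] /= /funext fg.
by rewrite fg in lf bf *; congr Bop; exact: Prop_irrelevance.
Qed.

Fact bop_zero_linear : linear (fun _ : H => 0 : H).
Proof. by move=> a x y; rewrite scaler0 addr0. Qed.
Fact bop_zero_bounded : exists M : R[i], forall x : H, `|0 : H| <= M * `|x|.
Proof. by exists 0 => x; rewrite normr0 mul0r. Qed.
Definition bop_zero := Bop bop_zero_linear bop_zero_bounded.

Fact bop_one_linear : linear (fun x : H => x).
Proof. by []. Qed.
Fact bop_one_bounded : exists M : R[i], forall x : H, `|x| <= M * `|x|.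
Proof. by exists 1 => x; rewrite mul1r. Qed.
Definition bop_one := Bop bop_one_linear bop_one_bounded.

Fact bop_add_linear S T : linear (fun x => S x + T x).
Proof. by move=> a x y; rewrite !bop_linear scalerDr addrACA. Qed.
Fact bop_add_bounded S T :
  exists M : R[i], forall x, `|S x + T x| <= M * `|x|.
Proof.
have [M SM] := bop_bounded S; have [M' TM] := bop_bounded T.
exists (M + M') => x; rewrite mulrDl.
by apply: le_trans (ler_normD _ _) _; exact: lerD.
Qed.
Definition bop_add S T := Bop (bop_add_linear S T) (bop_add_bounded S T).

Fact bop_scale_linear (c : R[i]) T : linear (fun x => c *: T x).
Proof.
by move=> a x y; rewrite bop_linear scalerDr !scalerA [c * a]mulrC.
Qed.
Fact bop_scale_bounded (c : R[i]) T :
  exists M : R[i], forall x, `|c *: T x| <= M * `|x|.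
Proof.
have [M TM] := bop_bounded T; exists (`|c| * M) => x.
by rewrite normrZ -mulrA ler_wpM2l.
Qed.
Definition bop_scale c T := Bop (bop_scale_linear c T) (bop_scale_bounded c T).

Definition bop_opp T := bop_scale (-1) T.

Fact bop_mul_linear S T : linear (fun x => S (T x)).
Proof. by move=> a x y; rewrite !bop_linear. Qed.
Fact bop_mul_bounded S T : exists M : R[i], forall x, `|S (T x)| <= M * `|x|.
Proof.
have [M SM] := bop_bounded S; have [M' TM] := bop_bounded T.
exists (`|M| * M') => x.
have Snorm y : `|S y| <= `|M| * `|y|.
  have := SM y; have [->|y0] := eqVneq y 0; first by rewrite normr0 !mulr0.
  move=> Sy; apply: le_trans Sy _; rewrite ler_wpM2r //.
  apply: real_ler_norm; have : 0 <= M * `|y| by apply: le_trans (SM y).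
  by rewrite pmulr_lge0 ?normr_gt0 // => M0; apply: ger0_real.
by apply: le_trans (Snorm _) _; rewrite -mulrA ler_wpM2l.
Qed.
Definition bop_mul S T := Bop (bop_mul_linear S T) (bop_mul_bounded S T).

Fact bop_addA : associative bop_add.
Proof. by move=> S T U; apply: bopP => x /=; rewrite addrA. Qed.
Fact bop_addC : commutative bop_add.
Proof. by move=> S T; apply: bopP => x /=; rewrite addrC. Qed.
Fact bop_add0 : left_id bop_zero bop_add.
Proof. by move=> S; apply: bopP => x /=; rewrite add0r. Qed.
Fact bop_addN : left_inverse bop_zero bop_opp bop_add.
Proof. by move=> S; apply: bopP => x /=; rewrite scaleN1r addNr. Qed.
HB.instance Definition _ :=
  GRing.isZmodule.Build B bop_addA bop_addC bop_add0 bop_addN.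

Let bop0 T : T 0 = 0.
Proof. by have := bop_linear T (-1) 0 0; rewrite scaler0 addr0 scaleN1r addNr. Qed.

Fact bop_mulA : associative bop_mul.
Proof. by move=> S T U; apply: bopP. Qed.
Fact bop_mul1 : left_id bop_one bop_mul.
Proof. by move=> S; apply: bopP. Qed.
Fact bop_mul1r : right_id bop_one bop_mul.
Proof. by move=> S; apply: bopP. Qed.
Fact bop_mulDl : left_distributive bop_mul +%R.
Proof. by move=> S T U; apply: bopP. Qed.
Fact bop_mulDr : right_distributive bop_mul +%R.
Proof.
move=> S T U; apply: bopP => x /=.
by have := bop_linear S 1 (T x) (U x); rewrite !scale1r.
Qed.
HB.instance Definition _ := GRing.Zmodule_isPzRing.Build B
  bop_mulA bop_mul1 bop_mul1r bop_mulDl bop_mulDr.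

Fact bop_scaleA (a b : R[i]) T : bop_scale a (bop_scale b T) = bop_scale (a * b) T.
Proof. by apply: bopP => x /=; rewrite scalerA. Qed.
Fact bop_scale1 : left_id 1 bop_scale.
Proof. by move=> T; apply: bopP => x /=; rewrite scale1r. Qed.
Fact bop_scaleDr : right_distributive bop_scale +%R.
Proof. by move=> a S T; apply: bopP => x /=; rewrite scalerDr. Qed.
Fact bop_scaleDl T : {morph bop_scale^~ T : a b / a + b}.
Proof. by move=> a b; apply: bopP => x /=; rewrite scalerDl. Qed.
HB.instance Definition _ := GRing.Zmodule_isLmodule.Build R[i] B
  bop_scaleA bop_scale1 bop_scaleDr bop_scaleDl.

Fact bop_scaleAl (c : R[i]) S T : c *: (S * T) = (c *: S) * T.
Proof. by apply: bopP. Qed.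

Fact bop_scaleAr (c : R[i]) S T : S * (c *: T) = c *: (S * T).
Proof.
apply: bopP => x; have := bop_linear S c (T x) 0.
by rewrite addr0 bop0 addr0.
Qed.

(* is_adjoint S T says that T is the Hilbert space adjoint of S; it exists and
   is unique for every bounded S *)
Definition is_adjoint S T := forall x y : H, hdot (S x) y = hdot x (T y).

Definition commutant (X : set B) : set B :=
  [set T | forall S, X S -> S * T = T * S].

Definition sqsummable (x : nat -> H) :=
  cvgn (series (fun n => `|x n| ^+ 2 : R[i]^o)).

(* Coarsest topology on B(H) making all a |-> \sum_n <a x_n, y_n> continuous,
   with \sum_n |x_n|^2 and \sum_n |y_n|^2 finite. *)
Definition ultraweak_eval (a : B) :
    {ptws (set_type [set p : (nat -> H) * (nat -> H) |
                      sqsummable p.1 /\ sqsummable p.2]) -> R[i]^o} :=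
  fun p => limn (series (fun n => hdot (a ((val p).1 n)) ((val p).2 n) : R[i]^o)).

HB.instance Definition _ :=
  Topological.copy B (initial_topology ultraweak_eval).

End BoundedOperators.

Record unitary (R : realType) (H : hilbertType R) := Unitary {
  unitary_op :> bop H;
  unitary_star : bop H;
  unitary_adj : is_adjoint unitary_op unitary_star;
  unitary_mulV : unitary_op * unitary_star = 1;
  unitary_Vmul : unitary_star * unitary_op = 1
}.

Section UnitaryGroup.
Context (R : realType) (H : hilbertType R).

HB.instance Definition _ := gen_eqMixin (unitary H).
HB.instance Definition _ := gen_choiceMixin (unitary H).

(* The strong operator topology: pointwise convergence in norm. *)
HB.instance Definition _ := Topological.copy (unitary H)
  (initial_topology (fun u : unitary H => (u : H -> H) : {ptws H -> H})).

End UnitaryGroup.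

Record vnAlg (R : realType) (H : hilbertType R) := VnAlg {
  vn_set : set (bop H);
  vn_star : forall a b, is_adjoint a b -> vn_set a -> vn_set b;
  vn_bicommutant : commutant (commutant vn_set) = vn_set
}.

Definition vn_sort (R : realType) (H : hilbertType R) (A : vnAlg H) : Type :=
  set_type (vn_set A).
Coercion vn_sort : vnAlg >-> Sortclass.

Section VonNeumannAlgebra.
Context (R : realType) (H : hilbertType R) (A : vnAlg H).

HB.instance Definition _ := SubChoice.on (vn_sort A).
HB.instance Definition _ :=
  Topological.copy (vn_sort A) (set_type (vn_set A)).

Fact commutant_subring_closed (X : set (bop H)) :
  subring_closed (fun a : bop H => a \in commutant X).
Proof.
split; first by rewrite inE => S _; rewrite mulr1 mul1r.
- by move=> a b; rewrite !inE => Xa Xb S XS; rewrite mulrBr mulrBl Xa // Xb.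
- move=> a b; rewrite !inE => Xa Xb S XS.
  by rewrite mulrA Xa // -mulrA Xb // mulrA.
Qed.

Fact commutant_scaler_closed (X : set (bop H)) :
  GRing.scaler_closed (fun a : bop H => a \in commutant X).
Proof.
move=> c a; rewrite !inE => Xa S XS; apply: bopP => x /=.
have -> : S (c *: a x) = c *: S (a x).
  have := bop_linear S c (a x) 0.
  rewrite addr0 => ->; have := bop_linear S (-1) 0 0.
  by rewrite scaler0 addr0 scaleN1r addNr => ->; rewrite addr0.
by congr (_ *: _); have := congr1 (fun T : bop H => T x) (Xa S XS).
Qed.

Fact vn_subring_closed : subring_closed (fun a : bop H => a \in vn_set A).
Proof. by rewrite -vn_bicommutant; exact: commutant_subring_closed. Qed.

Fact vn_submod_closed :
  GRing.subsemimod_closed (fun a : bop H => a \in vn_set A).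
Proof.
split; first exact: (Algebra.zmod_closed0D
  (GRing.subring_closedB vn_subring_closed)).
by rewrite -vn_bicommutant; exact: commutant_scaler_closed.
Qed.

HB.instance Definition _ := GRing.SubChoice_isSubPzRing.Build (bop H) _
  (vn_sort A) vn_subring_closed.
HB.instance Definition _ := GRing.SubZmodule_isSubLmodule.Build R[i] (bop H) _
  (vn_sort A) vn_submod_closed.

End VonNeumannAlgebra.

Lemma is_adjoint_sym (R : realType) (H : hilbertType R) (S T : bop H) :
  is_adjoint S T -> is_adjoint T S.
Proof.
have hdotC (x y : H) : hdot x y = Num.conj (hdot y x).
  by have := hermitian_subproof (s := hdot) x y; rewrite expr0 mul1r.
by move=> ST x y; rewrite hdotC -ST -hdotC.
Qed.

Section RepresentationCommutant.
Context (R : realType) (H : hilbertType R).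

Let hdot_inj (y z : H) : (forall x : H, hdot x y = hdot x z) -> y = z.
Proof.
move=> yz; apply/eqP; rewrite -subr_eq0 -normr_eq0 -sqrf_eq0 -hdotE.
by rewrite linearBr /= yz subrr.
Qed.

Section Family.
Context (I : Type) (pi : I -> unitary H).

Definition rep_commutant_set : set (bop H) :=
  commutant [set unitary_op (pi i) | i in setT].

Fact rep_commutant_star (a b : bop H) :
  is_adjoint a b -> rep_commutant_set a -> rep_commutant_set b.
Proof.
move=> ab ca _ [i _ <-]; set u := pi i; set v := unitary_star u.
have ua : unitary_op u * a = a * u by apply: ca; exists i.
have va : v * a = a * v.
  rewrite -[LHS]mulr1 -(unitary_mulV u) -/v -[v * a * _]mulrA (mulrA a) -ua.
  by rewrite -mulrA (mulrA v) unitary_Vmul mul1r.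
apply: bopP => y; apply: hdot_inj => x /=.
rewrite -(is_adjoint_sym (unitary_adj u)) -/v -ab -ab.
have := congr1 (fun T : bop H => T x) va => /= <-.
exact: (is_adjoint_sym (unitary_adj u)).
Qed.

Fact rep_commutant_bicommutant :
  commutant (commutant rep_commutant_set) = rep_commutant_set.
Proof.
apply/seteqP; split=> T cT S cS; last by apply/esym/cS.
by apply: cT => a ca; apply/esym/ca.
Qed.

(* The commutant of the set of operators [pi i]. *)
Definition rep_commutant : vnAlg H :=
  VnAlg rep_commutant_star rep_commutant_bicommutant.

End Family.
End RepresentationCommutant.

Record vnUnitary (R : realType) (H : hilbertType R) (A : vnAlg H) := VnUnitary {
  vnu_elt :> A;
  vnu_star : A;
  vnu_adj : is_adjoint (val vnu_elt) (val vnu_star);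
  vnu_mulV : vnu_elt * vnu_star = 1;
  vnu_Vmul : vnu_star * vnu_elt = 1
}.

Record vnAut (R : realType) (H : hilbertType R) (A : vnAlg H) := VnAut {
  vna_fun :> A -> A;
  vna_linear : linear vna_fun;
  vna_mul : {morph vna_fun : a b / a * b};
  vna_star : forall a b : A,
    is_adjoint (val a) (val b) -> is_adjoint (val (vna_fun a)) (val (vna_fun b));
  vna_bij : bijective vna_fun
}.

(* The predual, realized as the space of ultraweakly continuous functionals. *)
Record predual (R : realType) (H : hilbertType R) (A : vnAlg H) := Predual {
  pd_fun :> A -> R[i]^o;
  pd_linear : linear pd_fun;
  pd_continuous : continuous pd_fun
}.

Section UnitariesAndAutomorphisms.
Context (R : realType) (H : hilbertType R) (A : vnAlg H).

HB.instance Definition _ := gen_eqMixin (vnUnitary A).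
HB.instance Definition _ := gen_choiceMixin (vnUnitary A).
HB.instance Definition _ := Topological.copy (vnUnitary A)
  (initial_topology (@vnu_elt R H A)).

Fact vnu1_adj : is_adjoint (val (1 : A)) (val (1 : A)).
Proof. by []. Qed.

Definition vnu1 : vnUnitary A := VnUnitary vnu1_adj (mulr1 1) (mulr1 1).

Definition vn_unit_ball : set A :=
  [set a : A | forall x : H, `|(val a : bop H) x| <= `|x|].

Definition functional_norm (g : A -> R[i]^o) : \bar R :=
  ereal_sup [set (complex.Re `|g a|)%:E | a in vn_unit_ball].

HB.instance Definition _ := gen_eqMixin (vnAut A).
HB.instance Definition _ := gen_choiceMixin (vnAut A).

Definition uball (phi : vnAut A) (f : predual A) (e : R) : set (vnAut A) :=
  [set psi | (functional_norm (fun a => f (psi a) - f (phi a))%R < e%:E)%E].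

(* The u-topology, generated by the pseudometrics
   (phi, psi) |-> |f \o psi - f \o phi|. *)
HB.instance Definition _ := isSubBaseTopological.Build (vnAut A)
  [set B : set (vnAut A) | exists phi f e, 0 < e /\ B = uball phi f e] id.

Section Ad.
Variable u : vnUnitary A.

Definition Ad_fun (a : A) : A := vnu_elt u * a * vnu_star u.

Fact Ad_linear : linear Ad_fun.
Proof.
move=> c a b; rewrite /Ad_fun mulrDr mulrDl; congr (_ + _); apply: val_inj.
have mE (x y : A) : val (x * y) = (val x : bop H) * val y by [].
have zE (x : A) : val (c *: x) = c *: (val x : bop H) by [].
by rewrite !(mE, zE) bop_scaleAr -bop_scaleAl.
Qed.

Fact Ad_mul : {morph Ad_fun : a b / a * b}.
Proof.
move=> a b; rewrite /Ad_fun !mulrA; congr (_ * _ * _).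
by rewrite -[RHS]mulrA vnu_Vmul mulr1.
Qed.

Fact Ad_star (a b : A) : is_adjoint (val a) (val b) ->
  is_adjoint (val (Ad_fun a)) (val (Ad_fun b)).
Proof.
move=> ab x y; have uE := vnu_adj u; have vE := is_adjoint_sym uE.
have -> : (val (Ad_fun a) : bop H) x =
  (val (vnu_elt u) : bop H) ((val a : bop H) ((val (vnu_star u) : bop H) x)).
  by [].
by rewrite uE ab vE.
Qed.

Fact Ad_bij : bijective Ad_fun.
Proof.
exists (fun a => vnu_star u * a * vnu_elt u) => a; rewrite /Ad_fun.
- by rewrite !mulrA vnu_Vmul mul1r -mulrA vnu_Vmul mulr1.
- by rewrite !mulrA vnu_mulV mul1r -mulrA vnu_mulV mulr1.
Qed.

Definition Ad : vnAut A := VnAut Ad_linear Ad_mul Ad_star Ad_bij.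
End Ad.

End UnitariesAndAutomorphisms.

Section TwistedActions.
Context (K : topGroupType) (R : realType) (H : hilbertType R) (A : vnAlg H).
Implicit Types (alpha beta : K -> vnAut A) (sigma omega : K -> K -> vnUnitary A).

Record twisted_action alpha sigma : Prop := TwistedAction {
  tw_borel_alpha : borel_map alpha;
  tw_borel_sigma : borel_map (fun p : K * K => sigma p.1 p.2);
  tw_alpha1 : forall a, alpha 1%g a = a;
  tw_sigma1 : forall s, sigma 1%g s = vnu1 A /\ sigma s 1%g = vnu1 A;
  tw_comp : forall s t a,
    alpha s (alpha t a) = Ad (sigma s t) (alpha (s * t)%g a);
  tw_cocycle : forall r s t,
    alpha r (sigma s t) * (sigma r (s * t)%g : A) =
    (sigma r s : A) * (sigma (r * s)%g t : A)
}.

Definition exterior_equivalent alpha sigma beta omega : Prop :=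
  exists nu : K -> vnUnitary A,
    [/\ borel_map nu,
        forall s a, beta s a = Ad (nu s) (alpha s a) &
        forall s t, omega s t =
          (nu s : A) * alpha s (nu t) * (sigma s t : A) * vnu_star (nu (s * t)%g) :> A].

Definition vn_action beta : Prop :=
  continuous beta /\ forall s t a, beta (s * t)%g a = beta s (beta t a).

End TwistedActions.

Definition unitary_representation (K : topGroupType) (R : realType)
    (H : hilbertType R) (pi : K -> unitary H) : Prop :=
  continuous pi /\
  forall s t, unitary_op (pi (s * t)%g) = unitary_op (pi s) * unitary_op (pi t).

Definition unitarily_equivalent (K : Type) (R : realType) (H : hilbertType R)
    (pi rho : K -> unitary H) : Prop :=
  exists W : unitary H, forall n,
    unitary_op (rho n) = unitary_op W * unitary_op (pi n) * unitary_star W.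

Definition invariant_rep (G : topGroupType) (N : normalSubgroup G)
    (R : realType) (H : hilbertType R) (pi : N -> unitary H) : Prop :=
  forall s : G, unitarily_equivalent pi (fun n => pi (ns_conj s n)).

(* Main.v *)
(* Let E be the group of pairs (s, u) in G x U(H) with u pi(n) u^* = pi(s n s^-1)
   for all n in N.  It is closed in G x U(H), hence Polish, and the invariance of
   pi says that its projection to G is onto.  By the open mapping theorem for
   Polish groups the projection is open, so E -> G/N has a Borel section
   x |-> (c_x, W_x) with (c_1, W_1) = (1, 1).  Put alpha_x = Ad W_x and
   sigma(x, y) = W_x W_y pi(k)^* W_xy^* with k = c_xy^-1 c_x c_y.
   If rho extends pi, then nu_x = rho(c_x) W_x^* makes (alpha, sigma) exterior
   equivalent to the action Ad rho.  Conversely, an exterior equivalence nu with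
   an action yields a Borel homomorphism rho(g) = nu_x W_x pi(c_x^-1 g), x = gN,
   extending pi; it is continuous because Borel sets have the Baire property. *)
Require Import Defs.
From HB Require Import structures.
From mathcomp Require Import all_boot all_order all_algebra.
From mathcomp Require Import complex ring lra.
From mathcomp Require Import all_classical all_reals all_analysis.

Set Implicit Arguments.
Unset Strict Implicit.
Unset Printing Implicit Defensive.

Import Order.TTheory GRing.Theory Num.Theory.
Import numFieldNormedType.Exports.

Local Open Scope classical_set_scope.
Local Open Scope ring_scope.

(** * Baire category in topological groups *)

(** No metric appears: completeness is carried by [complete_covers], a list of smallness conditions
    such that a filter with a small member for each condition converges. This form passes to
    products and closed subspaces, and it feeds [nested_limit], the one limit construction behind
    Baire category, the open mapping theorem and the Borel section. Openness of E -> G matters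
    because, for an open map, the points whose fibre meets a given basic open set form an open set;
    choosing least indices of basic sets is then a Borel operation. Both components c_x and W_x have
    to come from one section: W_x W_y and W_xy pi(k) then implement the same element c_x c_y, so
    their quotient sigma(x, y) lies in the commutant. Two facts about topologies are needed besides:
    the strong and ultraweak topologies agree on the unitaries of the commutant, and conjugation by
    a strongly continuous family of unitaries is continuous for the u-topology, where convergence
    must be uniform over the unit ball. *)

Lemma dependent_choice_in (T : Type) (P : set T) (R : nat -> T -> T -> Prop) :
  (forall n x, P x -> exists2 y, P y & R n x y) -> forall x0, P x0 ->
  exists2 f : nat -> T, f 0%N = x0 & forall n, P (f n) /\ R n (f n) (f n.+1).
Proof.
move=> PR x0 Px0.
have next (n : nat) (x : {x | P x}) : {y : {x | P x} | R n (sval x) (sval y)}.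
  by apply: cid; case: (PR n _ (svalP x)) => y Py Ry; exists (exist _ y Py).
pose f := fix f n := if n is m.+1 then sval (next m (f m)) else exist _ x0 Px0.
exists (fun n => sval (f n)) => // n; split; first exact: svalP.
exact: (svalP (next n (f n))).
Qed.

Lemma morphg1 (G K : groupType) (f : G -> K) :
  {morph f : x y / x * y >-> x * y}%g -> f 1%g = 1%g.
Proof. by move=> fM; apply: (mulgI (f 1%g)); rewrite -fM !mulg1. Qed.

Lemma morphgV (G K : groupType) (f : G -> K) :
  {morph f : x y / x * y >-> x * y}%g -> {morph f : x / x^-1 >-> x^-1}%g.
Proof.
by move=> fM x; apply: (mulgI (f x)); rewrite -fM !mulgV (morphg1 fM).
Qed.

Section TopologicalGroup.
Context (G : topGroupType).
Implicit Types (g x : G) (U : set G).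

Lemma mulgl_continuous g : continuous (fun x => g * x)%g.
Proof.
move=> x; apply: (@continuous_comp _ _ _ (fun x : G => (g, x))
  (fun p : G * G => (p.1 * p.2)%g)); last exact: mulg_continuous.
by apply: cvg_pair; [exact: cvg_cst|exact: cvg_id].
Qed.

Lemma mulgr_continuous g : continuous (fun x => x * g)%g.
Proof.
move=> x; apply: (@continuous_comp _ _ _ (fun x : G => (x, g))
  (fun p : G * G => (p.1 * p.2)%g)); last exact: mulg_continuous.
by apply: cvg_pair; [exact: cvg_id|exact: cvg_cst].
Qed.

Lemma divg_continuous : continuous (fun p : G * G => p.1 / p.2)%g.
Proof.
move=> p; apply: (@continuous_comp _ _ _ (fun p : G * G => (p.1, p.2^-1)%g)
  (fun p : G * G => (p.1 * p.2)%g)); last exact: mulg_continuous.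
apply: cvg_pair; first exact: cvg_fst.
by apply: continuous_comp; [exact: cvg_snd|exact: invg_continuous].
Qed.

Lemma nbhs1_divg U : nbhs 1%g U ->
  exists V, [/\ open V, V 1%g & forall x y, V x -> V y -> U (x / y)%g].
Proof.
move=> nU; have : nbhs (1%g, 1%g) ((fun p : G * G => (p.1 / p.2)%g) @^-1` U).
  by apply: divg_continuous; rewrite /= divg1.
case=> -[A B] /= [nA nB] sAB.
have : nbhs 1%g (A `&` B) by exact: filterI.
rewrite nbhsE => -[V [oV V1] sV]; exists V; split=> // x y Vx Vy.
by apply: (sAB (x, y)); split; [apply: (sV _ Vx).1|apply: (sV _ Vy).2].
Qed.

(** Choose V with V V^-1 inside U x^-1. If y lies in the closure of V^-1 x, some z has both x/z and
    y/z in V, and (y/z)/(x/z) = y/x puts y in U. *)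
Lemma topGroup_regular : regular_space G.
Proof.
move=> x U nU.
have : nbhs 1%g ((fun z => z * x)%g @^-1` U).
  by apply: mulgr_continuous; rewrite mul1g.
move=> /nbhs1_divg[V [oV V1 VU]].
have divl (a b : G) W : nbhs (a / b)%g W -> nbhs b ((fun z => a / z)%g @^-1` W).
  by move=> nW; apply: continuous_comp nW; [exact: invg_continuous|
    exact: mulgl_continuous].
have nV a : nbhs a ((fun z => a / z)%g @^-1` V).
  by apply: divl; rewrite mulgV; apply: open_nbhs_nbhs.
exists ((fun z => x / z)%g @^-1` V); first exact: nV.
move=> y /(_ _ (nV y))[z [/= Vxz Vyz]].
by have := VU _ _ Vyz Vxz; rewrite mulgKA /= mulgVK.
Qed.

End TopologicalGroup.

Definition countable_base (T : topologicalType) (b : nat -> set T) :=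
  (forall n, open (b n)) /\
  forall x U, nbhs x U -> exists2 n, b n x & b n `<=` U.

Lemma second_countable_base (T : topologicalType) :
  @second_countable T -> exists b : nat -> set T, countable_base b.
Proof.
move=> [B cB [oB bB]]; have /countable_injP[g ginj] := cB.
exists (fun n => \bigcup_(U in [set U | B U /\ g U = n]) U); split.
  by move=> n; apply: bigcup_open => U [/oB].
move=> x U /bB[V [BV Vx] VU]; exists (g V); first by exists V.
move=> y [W [BW gWV] Wy]; apply: VU; rewrite -(ginj _ _ _ _ gWV) ?inE //.
Qed.

(* For a metric space, [small n] may be taken to be the sets of diameter at
   most 2^-n; this is Cech-completeness with the separation built in. *)
Definition complete_covers (T : topologicalType) (I : Type)
    (small : I -> set (set T)) :=
  [/\ forall i A B, A `<=` B -> small i B -> small i A,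
      forall i (x : T), exists2 U, nbhs x U & small i U &
      forall F, ProperFilter F -> (forall i, exists2 U, F U & small i U) ->
        exists x : T, F --> x].

Lemma complete_covers_nat (T : topologicalType) (I : countType)
    (small : I -> set (set T)) :
  complete_covers small ->
  exists small' : nat -> set (set T), complete_covers small'.
Proof.
move=> [sS sN sF].
exists (fun n => if unpickle n is Some i then small i else setT); split.
- by move=> n A B AB; case: unpickle => // i; exact: sS.
- move=> n x; case: unpickle => [i|]; first exact: sN.
  by exists setT => //; exact: filterT.
- by move=> F PF Fs; apply: sF => i; have := Fs (pickle i); rewrite pickleK.
Qed.

Section Complete.
Context (T : topologicalType) (small : nat -> set (set T)).
Hypothesis smallP : complete_covers small.

(** Smallness of the sets makes F converge; the limit lies in the closure of each [V n.+1], and the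
    closure condition brings it back into the sets [V n] themselves, which may be open. *)
Lemma nested_limit (V : nat -> set T) (F : set_system T) :
  ProperFilter F ->
  (forall n, [/\ F (V n), closure (V n.+1) `<=` V n & small n (V n.+1)]) ->
  exists x, F --> x /\ forall n, V n x.
Proof.
move=> PF FV; have [sS sN sF] := smallP.
have [x Fx] : exists x : T, F --> x.
  by apply: (sF F PF) => n; exists (V n.+1); [have [] := FV n.+1|have [] := FV n].
exists x; split=> // n; have [_ + _] := FV n; apply => U nU.
have FVU : F (V n.+1 `&` U) by apply: filterI; [have [] := FV n.+1|exact: Fx].
exact: filter_ex FVU.
Qed.

Lemma shrink (O : set T) (n : nat) : regular_space T -> open O ->
  forall x, O x ->
  exists2 V, [/\ open V, V x & closure V `<=` O] & small n V.
Proof.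
move=> reg oO x Ox; have [sS sN sF] := smallP; have [U nU sU] := sN n x.
have [V' nV' cV'] := reg x O (open_nbhs_nbhs (conj oO Ox)).
have : nbhs x (V' `&` U) by exact: filterI.
rewrite nbhsE => -[V [oV Vx] sV]; exists V; first split=> //.
  by apply: subset_trans cV'; apply: closureS => y /sV[].
by apply: sS sU => y /sV[].
Qed.

End Complete.

Definition baire_space (T : topologicalType) :=
  forall D : nat -> set T, (forall n, open (D n) /\ dense (D n)) ->
  dense (\bigcap_n D n).

(** The classical nested-ball argument: stage n shrinks the current open set into [D n], closure
    included, and makes it small of order n. The resulting decreasing sequence generates a filter to
    which [nested_limit] applies. *)
Lemma complete_covers_baire (T : topologicalType) (small : nat -> set (set T)) :
  complete_covers small -> regular_space T -> baire_space T.
Proof.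
move=> smallP reg D oD O O0 oO.
pose P (V : set T) := open V /\ V !=set0.
pose R n (V W : set T) := closure W `<=` V `&` D n /\ small n W.
have [|f f0 fP] := @dependent_choice_in _ P R _ O (conj oO O0).
  move=> n V [oV V0]; have [oDn /(_ V V0 oV)[x VDx]] := oD n.
  have [W [oW Wx cW] sW] := shrink smallP n reg (openI oV oDn) VDx.
  by exists W; split=> //; exists x.
have fS n : closure (f n.+1) `<=` f n.
  by case: (fP n) => _ [+ _] => /subset_trans; apply; apply: subIsetl.
have fS' n m : (n <= m)%N -> f m `<=` f n.
  move=> /subnK <-; elim: (m - n)%N => // k IH; rewrite addSn.
  by apply: subset_trans IH; apply: subset_trans (fS _); exact: subset_closure.
pose F := filter_from (@setT nat) f.
have PF : ProperFilter F.
  apply: filter_from_proper; last by move=> n _; case: (fP n) => -[].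
  apply: filter_from_filter; first by exists 0%N.
  move=> i j _ _; exists (maxn i j) => // x fx.
  by split; apply: fS' fx; rewrite (leq_maxl, leq_maxr).
have [|x [_ fx]] := @nested_limit _ _ smallP f F PF.
  by move=> n; split=> //; [exists n|case: (fP n) => _ []].
exists x; split; first by rewrite -f0.
move=> n _; have [_ [+ _]] := fP n.
by move=> /(_ x) []//; apply: subset_closure.
Qed.

Definition residual (T : topologicalType) (S : set T) :=
  exists2 D : nat -> set T, (forall n, open (D n) /\ dense (D n)) &
    \bigcap_n D n `<=` S.

Lemma residualS (T : topologicalType) (A B : set T) :
  A `<=` B -> residual A -> residual B.
Proof. by move=> AB [D oD DA]; exists D => //; exact: subset_trans AB. Qed.

Lemma residual_open_dense (T : topologicalType) (D : set T) :
  open D -> dense D -> residual D.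
Proof. by move=> oD dD; exists (fun=> D) => // x /(_ 0%N I). Qed.

Lemma residual_bigcap (T : topologicalType) (I : countType) (S : I -> set T) :
  (forall i, residual (S i)) -> residual (\bigcap_i S i).
Proof.
move=> rS; have /choice[D DP] : forall i, exists D : nat -> set T,
    (forall n, open (D n) /\ dense (D n)) /\ \bigcap_n D n `<=` S i.
  by move=> i; have [D oD DS] := rS i; exists D.
exists (fun n => if @unpickle (I * nat)%type n is Some (i, k) then D i k else setT).
  move=> n; case: unpickle => [[i k]|]; first exact: (DP i).1.
  split; first exact: openT.
  by move=> O [x Ox] _; exists x.
move=> x Dx i _; apply: (DP i).2 => k _.
by have := Dx (pickle (i, k)) Logic.I; rewrite pickleK.
Qed.

Lemma residualI (T : topologicalType) (A B : set T) :
  residual A -> residual B -> residual (A `&` B).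
Proof.
move=> rA rB; have : residual (\bigcap_(b : bool) (if b then A else B)).
  by apply: residual_bigcap => -[].
apply: residualS => x h; split; [exact: (h true)|exact: (h false)].
Qed.

Lemma residual_nonempty (T : topologicalType) (S W : set T) :
  baire_space T -> residual S -> open W -> W !=set0 -> W `&` S !=set0.
Proof.
move=> bT [D oD DS] oW W0; have [x [Wx Dx]] := bT D oD W W0 oW.
by exists x; split=> //; exact: DS.
Qed.

Lemma dense_preimage (T U : topologicalType) (h : T -> U) (h' : U -> T) D :
  continuous h' -> cancel h' h -> cancel h h' -> dense D -> dense (h @^-1` D).
Proof.
move=> ch' hK h'K dD O [x Ox] oO.
have [||y [Oy Dy]] := dD (h' @^-1` O).
- by exists (h x); rewrite /= h'K.
- by move/continuousP: ch'; apply.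
by exists (h' y); split=> //=; rewrite hK.
Qed.

Lemma residual_preimage (T U : topologicalType) (h : T -> U) (h' : U -> T) S :
  continuous h -> continuous h' -> cancel h' h -> cancel h h' ->
  residual S -> residual (h @^-1` S).
Proof.
move=> ch ch' hK h'K [D oD DS]; exists (fun n => h @^-1` D n).
  move=> n; have [oDn dDn] := oD n; split; last exact: dense_preimage dDn.
  by move/continuousP: ch; apply.
by move=> x Dx; apply: DS => n; exact: Dx.
Qed.

Section GroupBaire.
Context (G : topGroupType).
Hypothesis bG : baire_space G.
Implicit Types S W : set G.

Lemma residual_translate g S : residual S -> residual [set x | S (g * x)%g].
Proof.
apply: (@residual_preimage _ _ (fun x => g * x)%g (fun x => g^-1 * x)%g).
- exact: mulgl_continuous.
- exact: mulgl_continuous.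
- by move=> x; rewrite mulgA mulgV mul1g.
- by move=> x; rewrite mulgA mulVg mul1g.
Qed.

(* If W meets its translate by g^-1, then so does S, by the Baire property. *)
Lemma pettis S W : open W -> W !=set0 -> residual [set x | W x -> S x] ->
  nbhs 1%g [set g | exists x y, [/\ S x, S y & g = x / y]%g].
Proof.
move=> oW [w Ww] rS.
have nW : nbhs 1%g [set g : G | W (g * w)%g].
  by apply: mulgr_continuous; rewrite mul1g; exact: open_nbhs_nbhs.
apply: filterS nW => g /= Wgw.
have rS' := residualI rS (residual_translate g rS).
have [||x [[Wx Wgx] [Sx Sgx]]] :=
    residual_nonempty (W := W `&` (fun x => g * x)%g @^-1` W) bG rS'.
- apply: openI => //; have /continuousP := @mulgl_continuous _ g.
  exact.
- by exists w.
exists (g * x)%g, x; split; [exact: Sgx|exact: Sx|by rewrite mulgK].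
Qed.

End GroupBaire.

(** * The open mapping theorem *)

Section OpenMapping.
Context (E G : topGroupType) (f : E -> G) (b : nat -> set E)
  (small : nat -> set (set E)).
Hypotheses (cf : continuous f) (fM : {morph f : x y / x * y >-> x * y}%g).
Hypotheses (fsurj : forall g, exists e, f e = g).
Hypotheses (bE : countable_base b) (smallP : complete_covers small).
Hypotheses (bG : baire_space G) (hG : hausdorff_space G).

Let fV := morphgV fM.

Let hull (U : set E) : set G := (closure (f @` U))°.

(** With a dense sequence [e n] of E, the translates f(e_n) f(U) cover G. If f(U) were nowhere
    dense, this would contradict the Baire property of G. *)
Lemma nearly_open (U : set E) : open U -> U !=set0 -> hull U !=set0.
Proof.
move=> oU [u Uu]; apply: contrapT => h0.
have rC : residual (~` closure (f @` U)).
  apply: residual_open_dense; first by rewrite openC; exact: closed_closure.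
  move=> O [x Ox] oO; apply: contrapT => OC; apply: h0; exists x.
  apply: filterS (open_nbhs_nbhs (conj oO Ox)) => y Oy.
  by apply: contrapT => Cy; apply: OC; exists y.
have /choice[e eb] : forall n, exists x, b n !=set0 -> b n x.
  move=> n; have [[x bx]|b0] := pselect (b n !=set0); first by exists x.
  by exists u.
have [|x [_ Cx]] := residual_nonempty (W := [set: G]) bG
    (residual_bigcap (fun n => residual_translate (f (e n))^-1%g rC)) openT.
  by exists 1%g.
have [y fy] := fsurj x.
have : nbhs (y / u)%g [set z | U (z^-1 * y)%g].
  have -> : [set z | U (z^-1 * y)%g] =
      (fun z : E => z^-1)%g @^-1` ((fun z => z * y)%g @^-1` U) by [].
  apply: invg_continuous; apply: mulgr_continuous.
  by rewrite invgF mulgVK; exact: open_nbhs_nbhs.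
have [_ bb] := bE.
move=> /bb[n bny sbU]; apply: (Cx n I); apply: subset_closure.
have /sbU /= Ue : b n (e n) by apply: eb; exists (y / u)%g.
by exists ((e n)^-1 * y)%g => //; rewrite fM fV fy.
Qed.

(** An open O meeting [hull U] contains some f(e) with e in a [b n], n in P. Applying [nearly_open]
    to the part of [b n] lying over O yields a point of [hull (b n)] in O. The exterior of [hull U]
    is added to obtain density in all of G. *)
Let hull_bigcup (U : set E) (P : set nat) :
  U = \bigcup_(n in P) b n ->
  dense (\bigcup_(n in P) hull (b n) `|` ~` closure (hull U)).
Proof.
move=> UE O [x Ox] oO.
have [hUO|hUO] := pselect (O `&` hull U !=set0); last first.
  exists x; split=> //; right => cx.
  have [y [hy Oy]] := cx O (open_nbhs_nbhs (conj oO Ox)).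
  by apply: hUO; exists y.
have {hUO} [y [Oy hy]] := hUO.
have [_ [[e Ue <-] Oe]] : (f @` U) `&` O !=set0.
  by apply: (interior_subset hy); exact: open_nbhs_nbhs.
move: (Ue); rewrite UE => -[n Pn bne].
have [ob _] := bE.
have oO' : open (f @^-1` O) by move/continuousP: cf; apply.
have [|z hz] := nearly_open (openI (ob n) oO'); first by exists e.
have [_ [[w [bw Ow] <-] hw]] := interior_subset hz _ (nbhs_interior hz).
exists (f w); split=> //; left; exists n => //.
by apply: interiorS hw; apply: closureS; apply: image_subset; exact: subIsetl.
Qed.

Let mem_sub (n i : nat) : set nat :=
  [set j | closure (b j) `<=` b i /\ small n (b j)].

Let mem_subE n i : b i = \bigcup_(j in mem_sub n i) b j.
Proof.
have [ob bb] := bE; apply/seteqP; split=> [x bx|x [j [sj _] bx]]; last first.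
  by apply: sj; exact: subset_closure.
have [sS _ _] := smallP.
have [V [oV Vx cV] sV] := shrink smallP n (@topGroup_regular E) (ob i) bx.
have [j bjx bjV] := bb x V (open_nbhs_nbhs (conj oV Vx)).
exists j => //; split; last exact: sS sV.
exact: subset_trans (closureS bjV) cV.
Qed.

(* A point avoiding the exceptional sets has, at each stage, a smaller basic
   set whose image is still dense around it; the limit of these is a preimage. *)
Lemma residual_image (i : nat) :
  residual [set x | hull (b i) x -> (f @` b i) x].
Proof.
have [ob bb] := bE.
(* A point of [D (n, k)] that lies in [hull (b k)] cannot be in the exterior, so it lies in the hull
   of an order-n refinement of [b k]. This is what allows the descent to continue at every stage. *)
pose D (p : nat * nat) :=
  \bigcup_(j in mem_sub p.1 p.2) hull (b j) `|` ~` closure (hull (b p.2)).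
have rD : residual (\bigcap_p D p).
  apply: residual_bigcap => -[n k]; apply: residual_open_dense.
    apply: openU; last by rewrite openC; exact: closed_closure.
    by apply: bigcup_open => j _; exact: open_interior.
  exact: hull_bigcup (mem_subE n k).
apply: residualS rD => x Dx hx.
have [|k k0 kP] := @dependent_choice_in nat (fun j => hull (b j) x)
  (fun n j j' => mem_sub n j j') _ i hx.
  move=> n j hj; have [[j' mj' hj']|[]] := Dx (n, j) I; first by exists j'.
  exact: subset_closure.
(* The members pair the descending basic sets with preimages of neighbourhoods of x; they are
   nonempty because x stays in every [hull (b (k n))]. *)
pose F := filter_from [set p : nat * set G | nbhs x p.2]
  (fun p => b (k p.1) `&` f @^-1` p.2).
have kS n m : (n <= m)%N -> b (k m) `<=` b (k n).
  move=> /subnK <-; elim: (m - n)%N => // l IH; rewrite addSn.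
  apply: subset_trans IH; case: (kP (l + n)%N) => _ [+ _]; apply: subset_trans.
  exact: subset_closure.
have PF : ProperFilter F.
  apply: filter_from_proper; last first.
    move=> [n O] /= nO; have [hk _] := kP n.
    have [_ [[e be <-] Oe]] := interior_subset hk _ nO.
    by exists e.
  apply: filter_from_filter; first by exists (0%N, setT); exact: filterT.
  move=> [n O] [m O'] /= nO nO'.
  exists (maxn n m, O `&` O') => /=; first exact: filterI.
  move=> e [be [Oe Oe']]; split; split=> //; apply: kS be.
  - exact: leq_maxl.
  - exact: leq_maxr.
have [|e [Fe ke]] := nested_limit smallP (V := b \o k) PF.
  move=> n; have [_ [ck sk]] := kP n; split=> //.
  by exists (n, setT) => /=; [exact: filterT|move=> y []].
exists e; first by rewrite -k0; exact: ke.
(* The image of F converges to f(e) by continuity and to x by construction of F, so separation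
   forces f(e) = x. *)
apply: hG => A B nA nB.
have FA : F (f @^-1` A) by apply: Fe; exact: cf.
have FB : F (f @^-1` B) by exists (0%N, B) => //= y [].
have [y [Ay By]] := filter_ex (filterI FA FB).
by exists (f y).
Qed.

(** By [residual_image], f(b_i) fills the nonempty open set [hull (b i)] up to a meagre set, so
    [pettis] makes f(b_i) f(b_i)^-1 a neighbourhood of 1. Translation carries this from the identity
    to every point. *)
Theorem open_mapping (O : set E) : open O -> open (f @` O).
Proof.
move=> oO.
have f_nbhs1 (U : set E) : nbhs 1%g U -> nbhs 1%g (f @` U).
  move=> /nbhs1_divg[V [oV V1 VU]]; have [ob bb] := bE.
  have [i bi1 biV] := bb 1%g V (open_nbhs_nbhs (conj oV V1)).
  have bi0 : b i !=set0 by exists 1%g.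
  have := pettis bG (open_interior _) (nearly_open (ob i) bi0)
    (@residual_image i).
  apply: filterS => _ [_ [_ [[x bx <-] [y by_ <-] ->]]].
  by exists (x / y)%g; [apply: VU; exact: biV|rewrite fM fV].
rewrite openE => _ [e Oe <-].
have n1 : nbhs 1%g [set z | O (z * e)%g].
  by apply: mulgr_continuous; rewrite mul1g; exact: open_nbhs_nbhs.
have : nbhs (f e) [set y | (f @` [set z | O (z * e)%g]) (y / f e)%g].
  by apply: mulgr_continuous; rewrite mulgV; exact: f_nbhs1.
apply: filterS => y /= [z Oze fz]; exists (z * e)%g => //.
by rewrite fM fz mulgVK.
Qed.

End OpenMapping.

(** * Borel maps and Borel sections *)

Section Borel.
Implicit Types X Y Z : topologicalType.

Lemma borel_open X (A : set X) : open A -> <<s @open X >> A.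
Proof. exact: sub_sigma_algebra. Qed.

Lemma borelC X (A : set X) : <<s @open X >> A -> <<s @open X >> (~` A).
Proof.
move=> mA; rewrite -setTD.
by have [_ + _] := smallest_sigma_algebra setT (@open X); apply.
Qed.

Lemma borel_bigcup X (I : countType) (P : set I) (A : I -> set X) :
  (forall i, P i -> <<s @open X >> (A i)) -> <<s @open X >> (\bigcup_(i in P) A i).
Proof.
move=> mA; have [m0 _ mU] := smallest_sigma_algebra setT (@open X).
have -> : \bigcup_(i in P) A i =
    \bigcup_n (if unpickle n is Some i then [set x | P i /\ A i x] else set0).
  apply/seteqP; split=> [x [i Pi Ax]|x [n _]].
    by exists (pickle i) => //; rewrite pickleK.
  by case: unpickle => // i [Pi Ax]; exists i.
apply: mU => n; case: unpickle => // i; have [Pi|Pi] := pselect (P i).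
  by rewrite (_ : [set x | _] = A i); [exact: mA|apply/seteqP; split=> x // []].
by rewrite (_ : [set x | _] = set0)//; apply/seteqP; split=> x // [].
Qed.

Lemma borelU X (A B : set X) :
  <<s @open X >> A -> <<s @open X >> B -> <<s @open X >> (A `|` B).
Proof.
move=> mA mB; rewrite (_ : A `|` B = \bigcup_(c : bool) if c then A else B).
  by apply: borel_bigcup => -[].
apply/seteqP; split=> x; first by move=> [Ax|Bx]; [exists true|exists false].
by move=> [[] _ ?]; [left|right].
Qed.

Lemma borelI X (A B : set X) :
  <<s @open X >> A -> <<s @open X >> B -> <<s @open X >> (A `&` B).
Proof.
move=> mA mB; rewrite -(setCK (A `&` B)) setCI; apply: borelC.
by apply: borelU; exact: borelC.
Qed.

Lemma borel_map_openP X Y (f : X -> Y) :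
  (forall O, open O -> <<s @open X >> (f @^-1` O)) -> borel_map f.
Proof.
move=> fO; pose C := [set B | <<s @open X >> (f @^-1` B)].
suff : <<s @open Y >> `<=` C by move=> h B /h.
apply: smallest_sub => //; split.
- by rewrite /C /= preimage_set0; have [] := smallest_sigma_algebra setT (@open X).
- by move=> A CA; rewrite setTD; exact: borelC CA.
- by move=> A CA; rewrite /C /= preimage_bigcup; apply: borel_bigcup => n _; exact: CA.
Qed.

Lemma continuous_borel_map X Y (f : X -> Y) : continuous f -> borel_map f.
Proof.
move=> /continuousP cf; apply: borel_map_openP => O oO.
by apply: borel_open; exact: cf.
Qed.

Lemma borel_map_comp X Y Z (f : X -> Y) (g : Y -> Z) :
  borel_map f -> borel_map g -> borel_map (g \o f).
Proof. by move=> bf bg B mB; rewrite comp_preimage; apply: bf; exact: bg. Qed.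

(** The two bases make every open set of the product a countable union of rectangles, whose
    preimages are intersections of two Borel sets. *)
Lemma borel_map_pair X Y Z (b : nat -> set Y) (c : nat -> set Z)
    (f : X -> Y) (g : X -> Z) :
  countable_base b -> countable_base c ->
  borel_map f -> borel_map g -> borel_map (fun x => (f x, g x)).
Proof.
move=> [ob bb] [oc bc] bf bg; apply: borel_map_openP => O oO.
have -> : (fun x => (f x, g x)) @^-1` O = \bigcup_(p in [set p : nat * nat |
    b p.1 `*` c p.2 `<=` O]) (f @^-1` b p.1 `&` g @^-1` c p.2).
  apply/seteqP; split=> [x Ox|x [[n m] /= sO [bx cx]]]; last exact: (sO (f x, g x)).
  have [[U V] /= [nU nV] sUV] : nbhs (f x, g x) O by exact: open_nbhs_nbhs.
  have [n bn bU] := bb _ _ nU; have [m cm cV] := bc _ _ nV.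
  exists (n, m) => //= -[y z] /= [by_ cz].
  by apply: sUV; split; [exact: bU|exact: cV].
apply: borel_bigcup => -[n m] _; apply: borelI.
- by apply: bf; exact: borel_open.
- by apply: bg; exact: borel_open.
Qed.

Lemma countable_base_prod Y Z (b : nat -> set Y) (c : nat -> set Z) :
  countable_base b -> countable_base c ->
  exists d : nat -> set (Y * Z)%type, countable_base d.
Proof.
move=> [ob bb] [oc bc].
exists (fun k => if unpickle k is Some (n, m) then b n `*` c m else set0); split.
  move=> k; case: unpickle => [[n m]|]; last exact: open0.
  rewrite openE => -[y z] /= [by_ cz]; exists (b n, c m) => //=.
  by split; apply: open_nbhs_nbhs.
move=> [y z] O [[U V] /= [nU nV] sUV].
have [n bn bU] := bb _ _ nU; have [m cm cV] := bc _ _ nV.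
exists (pickle (n, m)); rewrite pickleK // => -[y' z'] /= [by_ cz].
by apply: sUV; split; [exact: bU|exact: cV].
Qed.

Lemma countable_base_initial (X : choiceType) Y (h : X -> Y) (b : nat -> set Y) :
  countable_base b ->
  countable_base (fun n => h @^-1` b n : set (initial_topology h)).
Proof.
move=> [ob bb]; split=> [n|x U]; first by exists (b n).
rewrite nbhsE => -[_ [[V oV <-] Vx] VU].
have [n bn bV] := bb _ _ (open_nbhs_nbhs (conj oV Vx)); exists n => //.
by move=> y /bV; exact: VU.
Qed.

End Borel.

Definition least (P : set nat) : nat :=
  if pselect (exists n, `[< P n >]) is left e then ex_minn e else 0%N.

Lemma leastP (P : set nat) : (exists n, P n) ->
  P (least P) /\ forall n, P n -> (least P <= n)%N.
Proof.
move=> P0; rewrite /least; case: pselect => [e|]; last first.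
  by case; case: P0 => n Pn; exists n; exact/asboolP.
by case: ex_minnP => n /asboolP Pn nmin; split=> // m /asboolP; exact: nmin.
Qed.

Lemma borel_least (X : topologicalType) (P : X -> set nat) i :
  (forall x, exists n, P x n) ->
  (forall n, <<s @open X >> [set x | P x n]) ->
  <<s @open X >> [set x | least (P x) = i].
Proof.
move=> P0 mP.
have -> : [set x | least (P x) = i] = [set x | P x i] `&`
    ~` (\bigcup_(j in [set j | (j < i)%N]) [set x | P x j]).
  apply/seteqP; split=> x /= .
    move=> <-; have [Pl lmin] := leastP (P0 x); split=> // -[j /= jl Pj].
    by move: jl; rewrite ltnNge lmin.
  move=> [Pi Pj]; have [Pl lmin] := leastP (P0 x).
  apply/eqP; rewrite eqn_leq lmin //= leqNgt; apply/negP => li.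
  by apply: Pj; exists (least (P x)).
by apply: borelI => //; apply: borelC; apply: borel_bigcup => j _.
Qed.

(** At each stage [idx] takes the least index of a small basic set that is nested in the previous
    one and still meets the fibre over x. Openness of f makes the condition of meeting the fibre
    open in x, so each [idx n] is Borel, and completeness turns the nested sets into a point
    [p x]. *)
Theorem borel_section (E K : topologicalType) (f : E -> K)
    (b : nat -> set E) (small : nat -> set (set E)) :
  continuous f -> (forall O, open O -> open (f @` O)) ->
  (forall x, exists e, f e = x) -> hausdorff_space K ->
  regular_space E -> countable_base b -> complete_covers small ->
  exists2 p : K -> E, borel_map p & forall x, f (p x) = x.
Proof.
move=> cf fo fsurj hK reg [ob bb] smallP.
pose sub n i j := closure (b j) `<=` b i /\ small n (b j).
have subP n i x : (f @` b i) x -> exists j, sub n i j /\ (f @` b j) x.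
  move=> [e be <-]; have [sS _ _] := smallP.
  have [V [oV Ve cV] sV] := shrink smallP n reg (ob i) be.
  have [j bj bjV] := bb e V (open_nbhs_nbhs (conj oV Ve)).
  exists j; split; last by exists e.
  split; last exact: sS sV.
  exact: subset_trans (closureS bjV) cV.
pose idx := fix idx n x := if n is m.+1 then
    least [set j | sub m (idx m x) j /\ (f @` b j) x]
  else least [set j | (f @` b j) x].
have idx_im n x : (f @` b (idx n x)) x.
  elim: n => [|n IH] /=; last by have [[]] := leastP (subP n _ _ IH).
  have [|] := @leastP [set j | (f @` b j) x]; last by [].
  have [e fe] := fsurj x; have [j bj _] := bb e setT filterT.
  by exists j, e.
have idx_sub n x : sub n (idx n x) (idx n.+1 x).
  by have [[]] := leastP (subP n _ _ (idx_im n x)).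
have bim j : <<s @open K >> (f @` b j) by apply: borel_open; exact: fo.
have idx_borel n i : <<s @open K >> [set x | idx n x = i].
  elim: n i => [|n IH] i /=; apply: borel_least.
  - by move=> x; exists (idx 0%N x); exact: (idx_im 0%N).
  - exact: bim.
  - by move=> x; exact: subP.
  - move=> j; have -> : [set x | sub n (idx n x) j /\ (f @` b j) x] =
        (\bigcup_(k in [set k | sub n k j]) [set x | idx n x = k]) `&` f @` b j.
      apply/seteqP; split=> x; first by move=> [sj fj]; split=> //; exists (idx n x).
      by move=> [[k /= sk kE] fj]; split=> //; rewrite kE.
    by apply: borelI => //; apply: borel_bigcup.
have lim x : exists e, (forall n, b (idx n x) e) /\
    forall U, nbhs e U -> exists n, b (idx n x) `<=` U.
  pose F := filter_from setT (fun n => b (idx n x)).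
  have bS n m : (n <= m)%N -> b (idx m x) `<=` b (idx n x).
    move=> /subnK <-; elim: (m - n)%N => // l IH; rewrite addSn.
    apply: subset_trans IH; case: (idx_sub (l + n)%N x) => + _.
    by apply: subset_trans; exact: subset_closure.
  have PF : ProperFilter F.
    apply: filter_from_proper; last first.
      by move=> n _; have [e be _] := idx_im n x; exists e.
    apply: filter_from_filter; first by exists 0%N.
    move=> n m _ _; exists (maxn n m) => // e be; split; apply: bS be.
    - exact: leq_maxl.
    - exact: leq_maxr.
  have [|e [Fe be]] := nested_limit smallP (V := fun n => b (idx n x)) PF.
    by move=> n; have [cn sn] := idx_sub n x; split=> //; exists n.
  by exists e; split=> // U /Fe[n _ bU]; exists n.
have [p pP] := choice lim; exists p.
  apply: borel_map_openP => O oO.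
  (* The sets [b (idx n x)] form a neighbourhood base at [p x], so membership of [p x] in O is
     already decided at some finite stage. *)
  have -> : p @^-1` O =
      \bigcup_(ni in [set ni : nat * nat | b ni.2 `<=` O]) [set x | idx ni.1 x = ni.2].
    apply/seteqP; split=> [x Opx|x [[n i] /= biO idE]].
      have [_ /(_ O)[|n bO]] := pP x; first exact: open_nbhs_nbhs.
      by exists (n, idx n x).
    by apply: biO; rewrite -idE; exact: (pP x).1.
  by apply: borel_bigcup => -[n i].
(* Nothing so far puts the limit in the fibre. However, every neighbourhood of [p x] contains some
   [b (idx n x)], which meets the fibre, so x and f(p x) cannot be separated. *)
move=> x; apply/esym; apply: hK => A B nA nB.
have [_ /(_ (f @^-1` B))[|n bB]] := pP x; first exact: cf.
have [e /bB /= Be fe] := idx_im n x.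
by exists x; split; [exact: nbhs_singleton|rewrite -fe].
Qed.

(** * The Baire property and automatic continuity of Borel homomorphisms *)

Definition baire_property (X : topologicalType) (S : set X) :=
  exists2 O : set X, open O & residual [set x | S x <-> O x].

Lemma dense_open_exterior (X : topologicalType) (O : set X) :
  dense (O `|` ~` closure O).
Proof.
move=> W [x Wx] oW; have [[y [Oy Wy]]|WO] := pselect (O `&` W !=set0).
  by exists y; split=> //; left.
by exists x; split=> //; right => /(_ W (open_nbhs_nbhs (conj oW Wx))).
Qed.

(** The sets equal to an open set up to a meagre set form a sigma-algebra. For complements the open
    set Q is replaced by its exterior, since the boundary of Q is nowhere dense; countable unions
    only intersect countably many residual sets. *)
Lemma borel_baire_property (X : topologicalType) (B : set X) :
  <<s @open X >> B -> baire_property B.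
Proof.
move: B; apply: smallest_sub; last first.
  move=> O oO; exists O => //; exists (fun=> setT) => // _; split; first exact: openT.
  by move=> W [x Wx] _; exists x.
split.
- exists set0; first exact: open0.
  exists (fun=> setT) => // _; split; first exact: openT.
  by move=> W [x Wx] _; exists x.
- move=> A [Q oO rA]; have oC : open (~` closure Q).
    by rewrite openC; exact: closed_closure.
  exists (~` closure Q) => //.
  have rO := residual_open_dense (openU oO oC) (@dense_open_exterior X Q).
  apply: residualS (residualI rA rO) => x [AO Ox].
  rewrite [X in _ X]/= setTD; split=> [Ax|nO /AO Ox'].
    by case: Ox => // /AO.
  by apply: nO; apply: subset_closure.
- move=> A AP; have /choice[Q OP] : forall n, exists Q : set X,
      open Q /\ residual [set x | A n x <-> Q x].
    by move=> n; have [Q oO rO] := AP n; exists Q.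
  exists (\bigcup_n Q n); first by apply: bigcup_open => n _; exact: (OP n).1.
  apply: residualS (residual_bigcap (fun n => (OP n).2)) => x AO.
  by split=> -[n _ h]; exists n => //; apply/(AO n Logic.I).
Qed.

(** Let W W^-1 lie in V. If rho^-1(W) is not meagre, [pettis] gives a neighbourhood of 1 mapped into
    V. If it were meagre, countably many of its translates would still cover G, because U has a
    countable base; this contradicts the Baire property. *)
Theorem borel_morphism_continuous (G U : topGroupType) (rho : G -> U)
    (b : nat -> set U) :
  baire_space G -> countable_base b -> borel_map rho ->
  {morph rho : x y / x * y >-> x * y}%g -> continuous rho.
Proof.
move=> bG [ob bb] brho rhoM.
have rhoV := morphgV rhoM.
have cont1 (V : set U) : nbhs 1%g V -> nbhs 1%g (rho @^-1` V).
  move=> /nbhs1_divg[W [oW W1 WV]].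
  have [Q oO rO] := borel_baire_property (brho _ (borel_open oW)).
  have [Q0|Q0] := pselect (Q !=set0).
    have rS : residual [set x | Q x -> (rho @^-1` W) x].
      by apply: residualS rO => x /= [].
    apply: filterS (pettis bG oO Q0 rS) => _ [x [y [Wx Wy ->]]] /=.
    by rewrite rhoM rhoV; exact: WV.
  have rW : residual [set x | ~ W (rho x)].
    by apply: residualS rO => x /= [+ _] => /[apply] Ox; apply: Q0; exists x.
  (* For each [b n] contained in some translate W rho(h), one such h is recorded as [g n]. These
     countably many translates cover the image of rho. *)
  have /choice[g gP] : forall n, exists g : G,
      (exists h : G, b n `<=` [set u | W (u / rho h)%g]) ->
      b n `<=` [set u | W (u / rho g)%g].
    by move=> n; have [[h hP]|nh] := pselect (exists h : G,
      b n `<=` [set u | W (u / rho h)%g]); [exists h|exists 1%g].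
  have rWg n : residual [set x | ~ W (rho (x / g n)%g)].
    apply: (@residual_preimage _ _ (fun x => x / g n)%g (fun x => x * g n)%g
      [set x | ~ W (rho x)]) => //.
    - exact: mulgr_continuous.
    - exact: mulgr_continuous.
    - by move=> x; rewrite mulgK.
    - by move=> x; rewrite mulgVK.
  have [||x [_ xP]] := residual_nonempty (W := [set: G]) bG (residual_bigcap rWg).
  - exact: openT.
  - by exists 1%g.
  have nx : nbhs (rho x) [set u | W (u / rho x)%g].
    by apply: mulgr_continuous; rewrite mulgV; exact: open_nbhs_nbhs.
  have [n bnx bW] := bb _ _ nx.
  case: (xP n I); rewrite rhoM rhoV; apply: (gP n) => //.
  by exists x.
move=> x V nV.
have : nbhs 1%g [set u | V (u * rho x)%g].
  by apply: mulgr_continuous; rewrite mul1g.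
move=> /cont1 n1.
have : nbhs x [set y | V (rho (y / x) * rho x)%g].
  apply: (@mulgr_continuous _ x^-1%g x (rho @^-1` [set u | V (u * rho x)%g])).
  by rewrite mulgV.
by apply: filterS => y /=; rewrite -rhoM mulgVK.
Qed.

(** The condition [None] asks for a relatively compact set and so provides a cluster point x. The
    condition for (n, m) turns it into a limit: if x lies in [b n], with closure inside [b m], a
    small set of the filter cannot miss [b n], hence lies in [b m]. Pairs that are not nested impose
    nothing. *)
Lemma locally_compact_complete_covers (G : topGroupType) (b : nat -> set G) :
  countable_base b -> locally_compact [set: G] ->
  exists small : nat -> set (set G), complete_covers small.
Proof.
move=> [ob bb] lcG.
pose small (i : option (nat * nat)) : set (set G) :=
  if i is Some (n, m) then
    [set U | closure (b n) `<=` b m -> U `<=` b m \/ U `&` b n = set0]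
  else [set U | precompact U].
apply: (@complete_covers_nat _ _ small); split.
- move=> [[n m]|] A B AB /=; last exact: precompact_subset.
  move=> sB /sB[Bm|Bn]; [left; exact: subset_trans Bm|right].
  by apply/seteqP; split=> // x [/AB Bx bx]; rewrite -Bn.
- move=> [[n m]|] x /=.
    have [cnm|cnm] := pselect (closure (b n) `<=` b m); last first.
      by exists setT => //; exact: filterT.
    have [bmx|bmx] := pselect (b m x).
      by exists (b m); [exact: open_nbhs_nbhs|left].
    exists (~` closure (b n)).
      apply: open_nbhs_nbhs; split; first by rewrite openC; exact: closed_closure.
      by move=> /cnm.
    move=> _; right; apply/seteqP; split=> // y [ny by_].
    by apply: ny; apply: subset_closure.
  have [V nV cV] := lcG x Logic.I; exists V; last by exists V.
  suff -> : V = [set y | [set: G] y -> V y] by [].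
  by apply/seteqP; split=> y /=; [move=> Vy _|apply].
move=> F PF Fs; have [U FU /=] := Fs None.
rewrite precompactE => cU.
have [x [_ clx]] := cU F PF (filterS (@subset_closure _ U) FU).
exists x => V nV.
have [m bmx bmV] := bb x V nV.
have [W nW cW] := topGroup_regular (open_nbhs_nbhs (conj (ob m) bmx)).
have [n bnx bnW] := bb x W nW.
have [U' FU' /(_ (subset_trans (closureS bnW) cW))[U'm|U'n]] := Fs (Some (n, m)).
  by apply: filterS FU'; exact: subset_trans bmV.
have [y] := clx _ _ FU' (open_nbhs_nbhs (conj (ob n) bnx)).
by rewrite U'n.
Qed.

(** * The unitary group of a separable Hilbert space *)

Section Hilbert.
Context (R : realType) (H : hilbertType R).
Implicit Types (x y : H) (S T : bop H).

Lemma hdotC x y : hdot x y = (hdot y x)^*.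
Proof. by have := hermitian_subproof (s := hdot) x y; rewrite expr0 mul1r. Qed.

Lemma norm_hdot x y : `|hdot x y| <= `|x| * `|y|.
Proof.
have [->|y0] := eqVneq y 0; first by rewrite linear0r normr0 mulr_ge0.
rewrite -ler_sqr ?nnegrE ?mulr_ge0 // exprMn.
have yy0 : 0 < hdot y y by rewrite hdotE exprn_gt0 // normr_gt0.
have dC : (hdot y y)^* = hdot y y by rewrite -hdotC.
(* Cauchy-Schwarz: this vector is <y, y> times the component of x orthogonal to y, and the scaling
   avoids a division. *)
have := exprn_ge0 2 (normr_ge0 (hdot y y *: x - hdot x y *: y)).
have -> : `|hdot y y *: x - hdot x y *: y| ^+ 2 =
    hdot y y * (hdot y y * hdot x x - hdot x y * (hdot x y)^*).
  rewrite -hdotE linearBl !linearBr /= !linearZl_LR !linearZr_LR /= dC (hdotC y x).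
  rewrite /GRing.scale /=; ring.
by rewrite pmulr_rge0 // subr_ge0 -normCK mulrC -!hdotE.
Qed.

Lemma bopB T x y : T (x - y) = T x - T y.
Proof.
have := bop_linear T (-1) y x.
by rewrite !scaleN1r ![- _ + _]addrC.
Qed.

Lemma adjoint_inj S T T' : is_adjoint S T -> is_adjoint S T' -> T = T'.
Proof.
move=> ST ST'; apply: bopP => y; apply/eqP; rewrite -subr_eq0 -normr_eq0.
by rewrite -sqrf_eq0 -hdotE linearBr /= -ST -ST' subrr.
Qed.

Lemma unitary_ext (u v : unitary H) : unitary_op u = unitary_op v -> u = v.
Proof.
case: u v => [u u' uu' u1 u2] [v v' vv' v1 v2] /= uv.
rewrite -uv in vv' v1 v2 *; have u'v' := adjoint_inj uu' vv'.
by rewrite -u'v' in vv' v1 v2 *; congr Unitary; exact: Prop_irrelevance.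
Qed.

Lemma unitary_starK (u : unitary H) x : unitary_star u (u x) = x.
Proof. by have /(congr1 (fun T : bop H => T x)) := unitary_Vmul u. Qed.

Lemma unitaryK (u : unitary H) x : u (unitary_star u x) = x.
Proof. by have /(congr1 (fun T : bop H => T x)) := unitary_mulV u. Qed.

Lemma norm_unitary (u : unitary H) x : `|u x| = `|x|.
Proof.
apply/eqP; rewrite -(@eqrXn2 _ 2) //; apply/eqP.
by rewrite -!hdotE unitary_adj unitary_starK.
Qed.

Lemma norm_unitary_star (u : unitary H) x : `|unitary_star u x| = `|x|.
Proof. by rewrite -(norm_unitary u) unitaryK. Qed.

Definition unitary1 : unitary H.
Proof. by apply: (@Unitary _ _ 1 1); rewrite ?mulr1. Defined.

Definition unitary_mul (u v : unitary H) : unitary H.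
Proof.
apply: (@Unitary _ _ (unitary_op u * unitary_op v) (unitary_star v * unitary_star u)).
- by move=> x y /=; rewrite unitary_adj unitary_adj.
- by apply: bopP => x /=; rewrite !unitaryK.
- by apply: bopP => x /=; rewrite !unitary_starK.
Defined.

Definition unitary_inv (u : unitary H) : unitary H :=
  Unitary (is_adjoint_sym (unitary_adj u)) (unitary_Vmul u) (unitary_mulV u).

Fact unitary_mulA : associative unitary_mul.
Proof. by move=> u v w; apply: unitary_ext; apply: mulrA. Qed.
Fact unitary_mul1 : left_id unitary1 unitary_mul.
Proof. by move=> u; apply: unitary_ext; apply: mul1r. Qed.
Fact unitary_mul1r : right_id unitary1 unitary_mul.
Proof. by move=> u; apply: unitary_ext; apply: mulr1. Qed.
Fact unitary_mulVl : left_inverse unitary1 unitary_inv unitary_mul.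
Proof. by move=> u; apply: unitary_ext; apply: unitary_Vmul. Qed.
Fact unitary_mulVr : right_inverse unitary1 unitary_inv unitary_mul.
Proof. by move=> u; apply: unitary_ext; apply: unitary_mulV. Qed.

HB.instance Definition _ := isGroup.Build (unitary H) unitary_mulA
  unitary_mul1 unitary_mul1r unitary_mulVl unitary_mulVr.

Lemma cvg_unitary (F : set_system (unitary H)) (u : unitary H) : Filter F ->
  (F --> u) <-> (forall x, (fun v : unitary H => (v : H -> H) x) @ F --> (u : H -> H) x).
Proof.
move=> FF; split=> [Fu x|Fu].
  move=> A nA.
  have : nbhs u [set v : unitary H | A ((v : H -> H) x)].
    pose h (v : unitary H) : {ptws H -> H} := (v : H -> H).
    have ch : continuous (h : unitary H -> {ptws H -> H}).
      exact: (@initial_continuous (unitary H) _ h).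
    apply: (ch u [set f : {ptws H -> H} | A (f x)]).
    exact: (@proj_continuous H (fun=> H) x (h u)).
  exact: Fu.
move=> A; rewrite nbhsE => -[_ [[B oB <-] Bu] BA].
pose h (v : unitary H) : {ptws H -> H} := (v : H -> H).
have hF : h @ F --> h u.
  apply/cvg_sup => x W; rewrite nbhsE => -[_ [[V oV <-] Vu] VW].
  apply: (filterS VW); apply: (Fu x V).
  exact: open_nbhs_nbhs.
by apply: (filterS BA); apply: hF; exact: open_nbhs_nbhs.
Qed.

Lemma continuous_unitary (Z : topologicalType) (f : Z -> unitary H) :
  continuous f <-> forall x, continuous (fun z => (f z : H -> H) x).
Proof.
split=> [cf x z|cf z].
  have := cf z; rewrite /= => /cvg_unitary/(_ x); exact.
by apply/cvg_unitary => x; exact: cf.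
Qed.
End Hilbert.

Section UnitaryTopGroup.
Context (R : realType) (H : hilbertType R).
Implicit Types (x y : H).

Lemma unitary_eval_continuous x : continuous (fun u : unitary H => (u : H -> H) x).
Proof. by move=> u; have /cvg_unitary := @cvg_id _ (nbhs u); apply. Qed.

Lemma unitary_eval_near (u : unitary H) x (e : R[i]) : 0 < e ->
  nbhs u [set v : unitary H | `|(u : H -> H) x - (v : H -> H) x| < e].
Proof.
by move=> e0; have /cvgrPdist_lt := @unitary_eval_continuous x u; apply.
Qed.

(** Splitting u v x - u' v' x as (u - u')(v x) + u'(v x - v' x) gives joint continuity, because u'
    is isometric and does not enlarge the second term. *)
Fact unitary_mulg_continuous :
  continuous (fun p : unitary H * unitary H => (p.1 * p.2)%g).
Proof.
apply/continuous_unitary => x [u v] /=.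
apply/cvgrPdist_lt => e e0; near=> p.
have -> : (u : H -> H) (v x) - (p.1 : H -> H) (p.2 x) =
    ((u : H -> H) (v x) - (p.1 : H -> H) (v x)) + (p.1 : H -> H) (v x - p.2 x).
  by rewrite bopB addrA subrK.
rewrite (splitr e); apply: le_lt_trans (ler_normD _ _) _; rewrite norm_unitary.
apply: ltrD; near: p.
- have : (fun p : unitary H * unitary H => (p.1 : H -> H) (v x)) @ (u, v) --> (u : H -> H) (v x).
    apply: (@cvg_comp _ _ _ fst (fun u : unitary H => (u : H -> H) (v x)) _ (nbhs u)).
      exact: cvg_fst.
    exact: unitary_eval_continuous.
  by move=> /cvgrPdist_lt; apply; rewrite divr_gt0.
- have : (fun p : unitary H * unitary H => (p.2 : H -> H) x) @ (u, v) --> (v : H -> H) x.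
    apply: (@cvg_comp _ _ _ snd (fun u : unitary H => (u : H -> H) x) _ (nbhs v)).
      exact: cvg_snd.
    exact: unitary_eval_continuous.
  by move=> /cvgrPdist_lt; apply; rewrite divr_gt0.
Unshelve. all: by end_near. Qed.

(** Applying the isometry v to u^* x - v^* x gives v(u^* x) - u(u^* x), so strong convergence at the
    single vector u^* x suffices. *)
Fact unitary_invg_continuous : continuous (fun u : unitary H => u^-1%g).
Proof.
apply/continuous_unitary => x u.
apply: (iffRL (@cvgrPdist_lt _ H _ (nbhs u) (nbhs_filter u)
  (fun v : unitary H => unitary_star v x) (unitary_star u x))) => e e0.
apply: filterS (unitary_eval_near u (unitary_star u x) e0) => v /=.
by rewrite -(norm_unitary v (unitary_star u x - _)) bopB !unitaryK distrC.
Qed.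

HB.instance Definition _ := Group_isTopGroup.Build (unitary H)
  unitary_mulg_continuous unitary_invg_continuous.

End UnitaryTopGroup.

(** * Countable base and completeness of the unitary group *)

Lemma complex_archi (R : realType) (e : R[i]) : 0 < e ->
  exists k : nat, k.+1%:R^-1 < e.
Proof.
case: e => a b; rewrite ltcE /= => /andP[/eqP b0 a0].
have /filter_ex[k ka] := near_infty_natSinv_lt (PosNum a0); exists k.
have -> : (k.+1%:R : R[i]) = (k.+1%:R : R)%:C%C by rewrite rmorph_nat.
by rewrite -fmorphV ltcE /= b0 eqxx.
Qed.

Section UnitaryPolish.
Context (R : realType) (H : hilbertType R) (xs : nat -> H).
Implicit Types (x y : H) (u v : unitary H).
Hypothesis xsP : forall x (e : R[i]), 0 < e -> exists n, `|x - xs n| < e.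

Let B (l : seq (nat * nat * nat)) : set (unitary H) := [set u | forall i j k,
  (i, j, k) \in l -> `|xs j - (u : H -> H) (xs i)| < k.+1%:R^-1].

Let open_B l : open (B l).
Proof.
elim: l => [|[[i j] k] l IH].
  rewrite (_ : B [::] = setT); first exact: openT.
  by apply/seteqP; split=> // u _ i j k; rewrite in_nil.
have -> : B ((i, j, k) :: l) = B l `&`
    (fun u : unitary H => (u : H -> H) (xs i)) @^-1` ball (xs j) k.+1%:R^-1.
  rewrite -ball_normE.
  apply/seteqP; split=> u.
    move=> Bu; split; last by apply: Bu; rewrite inE eqxx.
    by move=> i' j' k' l'; apply: Bu; rewrite inE l' orbT.
  move=> [Bu bu] i' j' k'; rewrite inE => /orP[/eqP[-> -> ->]//|]; exact: Bu.
apply: openI => //; have /continuousP := @unitary_eval_continuous _ H (xs i); apply.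
exact: ball_open.
Qed.

(** A basic set imposes finitely many conditions that u sends [xs i] close to [xs j]. Since
    unitaries are isometric, controlling them on the dense sequence controls them at every
    vector. *)
Lemma unitary_countable_base :
  countable_base (fun n => if unpickle n is Some l then B l else set0).
Proof.
split=> [n|u A nA]; first by case: unpickle => // ; exact: open0.
pose F := filter_from [set l | B l u] B.
have FF : Filter F.
  apply: filter_from_filter; first by exists [::].
  move=> l l' Bl Bl'; exists (l ++ l') => [i j k|v Bv].
    by rewrite mem_cat => /orP[]; [exact: Bl|exact: Bl'].
  by split=> i j k lk; apply: Bv; rewrite mem_cat lk ?orbT.
have Fu : F --> u.
  apply/cvg_unitary => x; apply/cvgrPdist_lt => e e0.
  have e4 : 0 < e / 4 by rewrite divr_gt0.
  have [i xi] := xsP x e4; have [k ke] := complex_archi e4.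
  have [j uj] := xsP (u (xs i)) (e := k.+1%:R^-1) ltac:(by rewrite invr_gt0).
  exists [:: (i, j, k)] => /= [i' j' k'|v].
    by rewrite inE => /eqP[-> -> ->]; rewrite distrC.
  move=> /(_ i j k (mem_head _ _)) vj.
  have -> : u x - (v : H -> H) x = u (x - xs i) + ((u (xs i) - xs j) +
      ((xs j - v (xs i)) + v (xs i - x))).
    by rewrite !bopB !addrA !subrK.
  have -> : e = e / 4 + (e / 4 + (e / 4 + e / 4)) by field.
  apply: le_lt_trans (ler_normD _ _) _; apply: ltrD; first by rewrite norm_unitary.
  apply: le_lt_trans (ler_normD _ _) _; apply: ltrD; first exact: lt_trans uj ke.
  apply: le_lt_trans (ler_normD _ _) _; apply: ltrD; first exact: lt_trans vj ke.
  by rewrite norm_unitary distrC.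
by have [l Bl lA] := Fu _ nA; exists (pickle l); rewrite pickleK.
Qed.

(** Adjoints are controlled as well: a strong limit of unitaries may be a non-surjective isometry,
    and convergence of the adjoints is what makes the limit invertible. *)
Let small (ik : nat * nat) : set (set (unitary H)) := [set U | forall u v, U u -> U v ->
  `|u (xs ik.1) - v (xs ik.1)| < ik.2.+1%:R^-1 /\
  `|unitary_star u (xs ik.1) - unitary_star v (xs ik.1)| < ik.2.+1%:R^-1].

Let small_limit (F : set_system (unitary H)) (g : unitary H -> unitary H) x :
  ProperFilter F -> (forall ik, exists2 U, F U & forall u v, U u -> U v ->
    `|g u (xs ik.1) - g v (xs ik.1)| < ik.2.+1%:R^-1) ->
  exists y, (fun u : unitary H => (g u : H -> H) x) @ F --> y.
Proof.
move=> PF Fs.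
have PF' : ProperFilter ((fun u : unitary H => (g u : H -> H) x) @ F) by exact: fmap_proper_filter.
suff /cauchy_cvg : cauchy ((fun u : unitary H => (g u : H -> H) x) @ F).
  by move=> /cvg_ex[y Fy]; exists y.
apply: cauchy_exP => e e0; have e3 : 0 < e / 3 by rewrite divr_gt0.
have [i xi] := xsP x e3; have [k ke] := complex_archi e3.
have [U FU Us] := Fs (i, k); have [v Uv] := filter_ex FU.
exists (g v x); suff : F [set u | ball (g v x : H) e (g u x)] by [].
apply: filterS FU => u Uu; rewrite -ball_normE /=.
have -> : g v x - g u x = g v (x - xs i) + ((g v (xs i) - g u (xs i)) +
    g u (xs i - x)) by rewrite !bopB !addrA !subrK.
have -> : e = e / 3 + (e / 3 + e / 3) by field.
apply: le_lt_trans (ler_normD _ _) _; apply: ltrD; first by rewrite norm_unitary.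
apply: le_lt_trans (ler_normD _ _) _; apply: ltrD; first exact: lt_trans (Us _ _ Uv Uu) ke.
by rewrite norm_unitary distrC.
Qed.

(** The filter has pointwise limits T of the unitaries and T' of their adjoints. The relations
    saying that T' is adjoint and inverse to T are inherited by approximating both limits with one
    unitary of the filter. *)
Lemma unitary_complete_covers : complete_covers small.
Proof.
split.
- by move=> ik A A' AA' sA' u v Au Av; apply: sA'; exact: AA'.
- move=> [i k] u; have k0 : 0 < k.+1%:R^-1 / 2 :> R[i] by rewrite divr_gt0 // invr_gt0.
  have nV : nbhs u ((fun v : unitary H => v^-1%g) @^-1`
      [set v : unitary H | `|(unitary_inv u : H -> H) (xs i) - (v : H -> H) (xs i)| < k.+1%:R^-1 / 2]).
    exact: (@invg_continuous (unitary H) u _ (unitary_eval_near (unitary_inv u) (xs i) k0)).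
  exists ([set v : unitary H | `|(u : H -> H) (xs i) - (v : H -> H) (xs i)| < k.+1%:R^-1 / 2] `&`
    (fun v : unitary H => v^-1%g) @^-1`
      [set v : unitary H | `|(unitary_inv u : H -> H) (xs i) - (v : H -> H) (xs i)| < k.+1%:R^-1 / 2]).
    by apply: filterI => //; exact: unitary_eval_near.
  move=> v w /= [v1 v2] [w1 w2].
  split.
  - rewrite [X in _ < X]splitr -(subrKA (u (xs i))); apply: le_lt_trans (ler_normD _ _) _.
    by apply: ltrD => //; rewrite distrC.
  - rewrite [X in _ < X]splitr -(subrKA (unitary_star u (xs i))); apply: le_lt_trans (ler_normD _ _) _.
    by apply: ltrD => //; rewrite distrC.
move=> F PF Fs.
have /choice[T FT] : forall x, exists y, (fun u : unitary H => (u : H -> H) x) @ F --> y.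
  move=> x; apply: (@small_limit F id) => // ik.
  have [U FU Us] := Fs ik; exists U => // u v Uu Uv; exact: (Us u v Uu Uv).1.
have /choice[T' FT'] : forall x, exists y, (fun u : unitary H => (unitary_star u : H -> H) x) @ F --> y.
  move=> x; apply: (@small_limit F (fun u => u^-1%g)) => // ik.
  have [U FU Us] := Fs ik; exists U => // u v Uu Uv; exact: (Us u v Uu Uv).2.
have limU := @norm_hausdorff _ H.
have limlin (g : unitary H -> bop H) (S : H -> H) :
    (forall x, (fun u => g u x) @ F --> S x) -> linear S.
  move=> FS a x y; apply: (cvg_unique limU (FS (a *: x + y))).
  rewrite (_ : (fun u => _) = (fun u => a *: g u x + g u y)); last first.
    by apply/funext => u; rewrite bop_linear.
  by apply: cvgD; [apply: cvgZr; exact: FS|exact: FS].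
have limnorm (g : unitary H -> bop H) (S : H -> H) :
    (forall u x, `|g u x| = `|x|) ->
    (forall x, (fun u => g u x) @ F --> S x) ->
    exists M : R[i], forall x, `|S x| <= M * `|x|.
  move=> gn FS; exists 1 => x; rewrite mul1r.
  have := cvg_norm (FS x); rewrite (_ : (fun u => _) = fun=> `|x|); last first.
    by apply/funext => u; rewrite gn.
  move=> h; have -> // : `|S x| = `|x|.
  have hc : (fun=> `|x|) @ F --> (`|x| : R[i]^o) by exact: cvg_cst.
  exact: (cvg_unique (@norm_hausdorff _ R[i]^o) (h _) hc).
pose TT := Bop (limlin _ _ FT) (limnorm _ _ (@norm_unitary R H) FT).
pose TT' := Bop (limlin _ _ FT') (limnorm _ _ (@norm_unitary_star R H) FT').
have approx x y (e : R[i]) : 0 < e -> exists u : unitary H,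
    `|T x - u x| < e /\ `|T' y - unitary_star u y| < e.
  move=> e0; apply: (@filter_ex _ F); apply: filterI.
  - by have /cvgrPdist_lt := FT x; apply.
  - by have /cvgrPdist_lt := FT' y; apply.
have eq_approx x y : (forall e : R[i], 0 < e -> `|x - y| <= e) -> x = y.
  move=> xy; have [//|] := eqVneq x y; rewrite -subr_eq0 -normr_gt0 => d0.
  have d2 : 0 < `|x - y| / 2 by rewrite divr_gt0.
  have := xy _ d2; rewrite ler_pdivlMr // mulr_natr mulr2n gerDl.
  by rewrite (lt_geF d0).
have adjT : is_adjoint TT TT'.
  move=> x y /=; have [//|] := eqVneq (hdot (T x) y) (hdot x (T' y)).
  rewrite -subr_eq0 -normr_gt0 => d0.
  (* With s = |x| + |y|, the estimate bounds the supposed discrepancy d by d s/(s + 1), which is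
     absurd for d > 0. *)
  have s0 : 0 < `|x| + `|y| + 1 by rewrite ltr_wpDl // addr_ge0.
  have [u [ux uy]] := approx x y _ (divr_gt0 d0 s0).
  have dE : hdot (T x) y - hdot x (T' y) =
      hdot (T x - u x) y + hdot x (unitary_star u y - T' y).
    by rewrite linearBl linearBr /= unitary_adj addrA subrK.
  have : `|hdot (T x) y - hdot x (T' y)| <=
      `|hdot (T x) y - hdot x (T' y)| / (`|x| + `|y| + 1) * (`|x| + `|y|).
    rewrite {1}dE; apply: le_trans (ler_normD _ _) _; rewrite mulrDr addrC.
    apply: lerD; apply: le_trans (norm_hdot _ _) _.
    - by rewrite mulrC ler_wpM2r // distrC ltW.
    - by rewrite ler_wpM2r // ltW.
  rewrite mulrAC ler_pdivlMr // ler_pM2l // gerDl.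
  by rewrite (lt_geF ltr01).
have mulT : TT * TT' = 1.
  apply: bopP => x /=; apply: eq_approx => e e0.
  have e2 : 0 < e / 2 by rewrite divr_gt0.
  have [u [ux uy]] := approx (T' x) x _ e2.
  have -> : T (T' x) - x = (T (T' x) - u (T' x)) + u (T' x - unitary_star u x).
    by rewrite bopB unitaryK addrA subrK.
  rewrite (splitr e); apply: le_trans (ler_normD _ _) _; apply: lerD.
  - exact: ltW.
  - by rewrite norm_unitary ltW.
have Tmul : TT' * TT = 1.
  apply: bopP => x /=; apply: eq_approx => e e0.
  have e2 : 0 < e / 2 by rewrite divr_gt0.
  have [u [ux uy]] := approx x (T x) _ e2.
  have -> : T' (T x) - x = (T' (T x) - unitary_star u (T x)) + unitary_star u (T x - u x).
    by rewrite bopB unitary_starK addrA subrK.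
  rewrite (splitr e); apply: le_trans (ler_normD _ _) _; apply: lerD.
  - exact: ltW.
  - by rewrite norm_unitary_star ltW.
exists (Unitary adjT mulT Tmul); apply/cvg_unitary => x /=; exact: FT.
Qed.

End UnitaryPolish.

Lemma separable_dense_seq (R : realType) (H : hilbertType R) :
  separable H -> exists xs : nat -> H,
    forall x (e : R[i]), 0 < e -> exists n, `|x - xs n| < e.
Proof.
move=> [D cD dD].
have [x0 _] : D !=set0 by have [|x [_ Dx]] := dD setT _ openT; [exists 0|exists x].
have /countable_injP[g ginj] := cD.
have /choice[xs xsP] : forall n, exists x, (exists2 y, D y & g y = n) -> D x /\ g x = n.
  move=> n; have [[y Dy gy]|h] := pselect (exists2 y, D y & g y = n); first by exists y.
  by exists 0.
exists xs => x e e0.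
have ob : open (ball x e) by exact: ball_open.
have [|y [xy Dy]] := dD (ball x e) _ ob; first by exists x; exact: ballxx.
exists (g y); have [|Dxs gE] := xsP (g y); first by exists y.
by rewrite (ginj _ _ _ _ gE) ?inE //; move: xy; rewrite -ball_normE.
Qed.

(** * Products, subgroups and quotients *)

Lemma continuous_pair (Z X Y : topologicalType) (f : Z -> X) (g : Z -> Y) :
  continuous f -> continuous g -> continuous (fun z => (f z, g z)).
Proof. by move=> cf cg z; apply: cvg_pair; [exact: cf|exact: cg]. Qed.

Section ProductTopGroup.
Context (G K : topGroupType).

Fact pair_mulg_continuous :
  continuous (fun p : (G * K) * (G * K) => (p.1 * p.2)%g).
Proof.
apply: (@continuous_pair _ _ _
  (fun p : (G * K) * (G * K) => (p.1.1 * p.2.1)%g)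
  (fun p : (G * K) * (G * K) => (p.1.2 * p.2.2)%g)) => p.
- apply: (@continuous_comp _ _ _ (fun p : (G * K) * (G * K) => (p.1.1, p.2.1))
    (fun q : G * G => (q.1 * q.2)%g)); last exact: mulg_continuous.
  by apply: cvg_pair; apply: continuous_comp;
    [exact: cvg_fst|exact: cvg_fst|exact: cvg_snd|exact: cvg_fst].
- apply: (@continuous_comp _ _ _ (fun p : (G * K) * (G * K) => (p.1.2, p.2.2))
    (fun q : K * K => (q.1 * q.2)%g)); last exact: mulg_continuous.
  by apply: cvg_pair; apply: continuous_comp;
    [exact: cvg_fst|exact: cvg_snd|exact: cvg_snd|exact: cvg_snd].
Qed.

Fact pair_invg_continuous : continuous (fun p : G * K => p^-1%g).
Proof.
apply: (@continuous_pair _ _ _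
  (fun p : G * K => p.1^-1%g) (fun p : G * K => p.2^-1%g)) => p.
- by apply: continuous_comp; [exact: cvg_fst|exact: invg_continuous].
- by apply: continuous_comp; [exact: cvg_snd|exact: invg_continuous].
Qed.

HB.instance Definition _ := Group_isTopGroup.Build (G * K)%type
  pair_mulg_continuous pair_invg_continuous.

End ProductTopGroup.

Record subgroup (P : groupType) := Subgroup {
  sg_set : set P;
  sg_closed : group_closed (fun x : P => x \in sg_set)
}.

Definition sg_sort (P : groupType) (S : subgroup P) : Type :=
  set_type (sg_set S).
Coercion sg_sort : subgroup >-> Sortclass.

Section SubgroupType.
Context (P : groupType) (S : subgroup P).
HB.instance Definition _ := SubChoice.on (sg_sort S).
HB.instance Definition _ :=
  SubChoice_isSubGroup.Build P _ (sg_sort S) (sg_closed S).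
End SubgroupType.

Section SubgroupTopology.
Context (P : topGroupType) (S : subgroup P).

HB.instance Definition _ :=
  Topological.copy (sg_sort S) (set_type (sg_set S)).

Lemma sg_val_continuous : continuous (val : sg_sort S -> P).
Proof. exact: (@initial_continuous (set_type (sg_set S)) P set_val). Qed.

Lemma sg_continuous (Z : topologicalType) (f : Z -> sg_sort S) :
  continuous (fun z => val (f z)) -> continuous f.
Proof.
move=> cf; apply/continuousP => A [B oB <-].
by move/continuousP: cf => /(_ B oB).
Qed.

Fact sg_mulg_continuous :
  continuous (fun p : sg_sort S * sg_sort S => (p.1 * p.2)%g).
Proof.
apply: sg_continuous => p.
apply: (@continuous_comp _ _ _
  (fun z : sg_sort S * sg_sort S => (val z.1, val z.2))
  (fun q : P * P => (q.1 * q.2)%g)); last exact: mulg_continuous.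
apply: cvg_pair => /=.
- by apply: continuous_comp; [exact: cvg_fst|exact: sg_val_continuous].
- by apply: continuous_comp; [exact: cvg_snd|exact: sg_val_continuous].
Qed.

Fact sg_invg_continuous : continuous (fun x : sg_sort S => x^-1%g).
Proof.
apply: sg_continuous => x.
have -> : (fun z : sg_sort S => val z^-1%g) = (fun y : P => y^-1%g) \o val by [].
by apply: continuous_comp; [exact: sg_val_continuous|exact: invg_continuous].
Qed.

HB.instance Definition _ :=
  Group_isTopGroup.Build (sg_sort S) sg_mulg_continuous sg_invg_continuous.

End SubgroupTopology.

Lemma complete_covers_prod (X Y : topologicalType) (I J : Type)
    (sX : I -> set (set X)) (sY : J -> set (set Y)) :
  complete_covers sX -> complete_covers sY ->
  complete_covers (fun ij : I + J => match ij with
    | inl i => [set A : set (X * Y) | sX i (fst @` A)]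
    | inr j => [set A : set (X * Y) | sY j (snd @` A)] end).
Proof.
move=> [sXS sXN sXF] [sYS sYN sYF]; split.
- by move=> [i|j] A B AB; [apply: sXS|apply: sYS]; exact: image_subset.
- move=> [i|j] [x y].
    have [U nU sU] := sXN i x; exists (fst @^-1` U); first exact: cvg_fst nU.
    by apply: sXS sU => _ [z Uz <-].
  have [U nU sU] := sYN j y; exists (snd @^-1` U); first exact: cvg_snd nU.
  by apply: sYS sU => _ [z Uz <-].
move=> F PF Fs.
have [x Fx] : exists x : X, fst @ F --> x.
  apply: (sXF (fst @ F) (fmap_proper_filter _ PF)) => i.
  have [U FU sU] := Fs (inl i); exists (fst @` U) => //.
  by apply: (@filterS _ F _ U _ _ FU) => z Uz; exists z.
have [y Fy] : exists y : Y, snd @ F --> y.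
  apply: (sYF (snd @ F) (fmap_proper_filter _ PF)) => j.
  have [U FU sU] := Fs (inr j); exists (snd @` U) => //.
  by apply: (@filterS _ F _ U _ _ FU) => z Uz; exists z.
exists (x, y) => A [[U V] /= [nU nV] UV].
have FU := Fx _ nU; have FV := Fy _ nV.
apply: (@filterS _ F _ ((fst @^-1` U) `&` (snd @^-1` V))); last exact: filterI.
by move=> [a b] [Ua Vb]; exact: (UV (a, b)).
Qed.

(** The limit is found in Y. Closedness of the image provides a point of X above it, and the initial
    topology lifts the convergence. *)
Lemma complete_covers_initial (X : choiceType) (Y : topologicalType)
    (I : Type) (h : X -> Y) (small : I -> set (set Y)) :
  closed (h @` setT) -> complete_covers small ->
  complete_covers (fun i => [set A : set (initial_topology h) | small i (h @` A)]).
Proof.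
move=> ch [sS sN sF]; split.
- by move=> i A B AB; apply: sS; exact: image_subset.
- move=> i x; have [U nU sU] := sN i (h x); exists (h @^-1` U).
    exact: (@initial_continuous _ _ h).
  by apply: sS sU => _ [z Uz <-].
move=> F PF Fs.
have [y Fy] : exists y : Y, h @ F --> y.
  apply: (sF (h @ F) (fmap_proper_filter _ PF)) => i.
  have [U FU sU] := Fs i; exists (h @` U) => //.
  by apply: (@filterS _ F _ U _ _ FU) => z Uz; exists z.
have [x _ hx] : (h @` setT) y.
  apply: ch => B nB; have [z hz] := @filter_ex _ F PF (h @^-1` B) (Fy _ nB).
  by exists (h z); split=> //; exists z.
exists x => A; rewrite nbhsE => -[_ [[V oV <-] Vx] VA].
by apply: (filterS VA); apply: (Fy V); apply: open_nbhs_nbhs; rewrite -hx.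
Qed.

Section QuotientMap.
Context (G : topGroupType) (N : normalSubgroup G).
Local Open Scope quotient_scope.

Definition qmap (x : G) : quotient_group N := \pi_(quotient_group N) x.

Lemma qmapP (x y : G) : ns_set N (x^-1 * y)%g <-> qmap x = qmap y.
Proof.
split=> [Nxy|/eqmodP]; last by rewrite /= /coset_eq inE.
by apply/eqmodP; rewrite /= /coset_eq inE.
Qed.

Lemma qmap_surj (a : quotient_group N) : exists x, qmap x = a.
Proof. by exists (repr a); exact: reprK. Qed.

Lemma qmapM : {morph qmap : x y / x * y >-> x * y}%g.
Proof. by move=> x y; rewrite [RHS]qmulE. Qed.

Lemma qmap1 : qmap 1%g = 1%g.
Proof. by []. Qed.

Lemma qmap_continuous : continuous qmap.
Proof. exact: (@pi_continuous G {eq_quot coset_equiv N}). Qed.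

Lemma qmap_open (U : set G) : open U -> open (qmap @` U).
Proof.
move=> oU.
have -> : open (qmap @` U) = open (qmap @^-1` (qmap @` U)) by [].
have -> : qmap @^-1` (qmap @` U) =
    \bigcup_(n in ns_set N) (fun x : G => (x * n)%g) @^-1` U.
  apply/seteqP; split=> x /=.
    move=> [u Uu] /esym/qmapP Nn; exists (x^-1 * u)%g => //=.
    by rewrite mulgA mulgV mul1g.
  move=> [n Nn /= Uxn]; exists (x * n)%g => //; apply/esym/qmapP.
  by rewrite mulgA mulVg mul1g.
by apply: bigcup_open => n _; move: (@mulgr_continuous _ n) => /continuousP; apply.
Qed.

Lemma continuous_qmap (Z : topologicalType) (f : quotient_group N -> Z) :
  continuous (f \o qmap) -> continuous f.
Proof. by move=> cf; apply/(@quotient_continuous G {eq_quot coset_equiv N}). Qed.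

(** If x^-1 y is not in N, a neighbourhood product U V of (x^-1, y) avoids N. The images of U^-1 and
    V, neighbourhoods because [qmap] is open, are then disjoint. *)
Lemma quotient_hausdorff : closed (ns_set N) -> hausdorff_space (quotient_group N).
Proof.
move=> cN a b ab; have [x xa] := qmap_surj a; have [y yb] := qmap_surj b.
rewrite -xa -yb in ab *; apply/qmapP; apply: contrapT => Nxy.
have : nbhs (x^-1%g, y) [set p : G * G | ~ ns_set N (p.1 * p.2)%g].
  apply: (@mulg_continuous G (x^-1%g, y) (~` ns_set N)).
  by apply: open_nbhs_nbhs; split=> //; rewrite openC.
move=> [[U V] /= [nU nV] UV].
have nU' : nbhs x ((fun z : G => z^-1)%g @^-1` U) by exact: invg_continuous.
have imn (z : G) W : nbhs z W -> nbhs (qmap z) (qmap @` W).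
  rewrite nbhsE => -[W' [oW' Wz] W'W].
  apply: (@filterS _ _ _ (qmap @` W')); first exact: image_subset.
  by apply: open_nbhs_nbhs; split; [exact: qmap_open|exists z].
have [_ [[u Uu <-] [v Vv vu]]] := ab _ _ (imn _ _ nU') (imn _ _ nV).
by apply: (UV (u^-1%g, v)) => //=; apply/qmapP.
Qed.

End QuotientMap.

(** * The group of implementing unitaries *)

Lemma closed_equalizer (X Y : topologicalType) (f g : X -> Y) :
  hausdorff_space Y -> continuous f -> continuous g ->
  closed [set x | f x = g x].
Proof.
move=> hY cf cg x cx; apply: hY => A B nA nB.
have nAB : nbhs x (f @^-1` A `&` g @^-1` B).
  by apply: filterI; [exact: cf|exact: cg].
have [y [fgy [Ay By]]] := cx _ nAB.
by exists (f y); split=> //; rewrite fgy.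
Qed.

Lemma unitary_hausdorff (R : realType) (H : hilbertType R) :
  hausdorff_space (unitary H).
Proof.
move=> u v uv; apply: unitary_ext; apply: bopP => x.
apply: (@norm_hausdorff _ H) => A B nA nB.
pose ev (w : unitary H) := (w : H -> H) x.
have cev : continuous ev by exact: unitary_eval_continuous.
have [w [Aw Bw]] := uv (ev @^-1` A) (ev @^-1` B) (cev u A nA) (cev v B nB).
by exists (w x).
Qed.

Lemma unitary_opM (R : realType) (H : hilbertType R) (u v : unitary H) :
  unitary_op (u * v)%g = unitary_op u * unitary_op v.
Proof. by []. Qed.

Section ImplementingGroup.
Context (G : topGroupType) (N : normalSubgroup G) (R : realType)
  (H : hilbertType R) (pi : N -> unitary H).

Lemma ns_conj1 (n : N) : ns_conj 1%g n = n.
Proof. by apply: val_inj; rewrite /= mul1g divg1. Qed.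

Lemma ns_conjM (s t : G) (n : N) :
  ns_conj (s * t)%g n = ns_conj s (ns_conj t n).
Proof. by apply: val_inj; rewrite /= invgM !mulgA. Qed.

Lemma ns_conj_val (m n : N) : ns_conj (val m) n = (m * n * m^-1)%g.
Proof. exact: val_inj. Qed.

Lemma ns_continuous (Z : topologicalType) (f : Z -> ns_sort N) :
  continuous (fun z => val (f z)) -> continuous f.
Proof.
move=> cf; apply/continuousP => A [B oB <-].
by move/continuousP: cf => /(_ B oB).
Qed.

Lemma ns_borel (Z : topologicalType) (f : Z -> ns_sort N) :
  borel_map (fun z => val (f z)) -> borel_map f.
Proof.
move=> bf; apply: borel_map_openP => A [B oB <-].
exact: (bf B (borel_open oB)).
Qed.

Lemma ns_conj_continuous (n : N) : continuous (fun s : G => ns_conj s n).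
Proof.
apply: ns_continuous => s.
apply: (@continuous_comp _ _ _ (fun s : G => (s * val n, s)%g)
  (fun p : G * G => (p.1 / p.2)%g)); last exact: divg_continuous.
by apply: (@continuous_pair _ _ _ (fun s : G => s * val n)%g id) => //;
  [exact: mulgr_continuous|move=> ?; exact: cvg_id].
Qed.

(** Written without inverses. For s = 1 it says that u commutes with every pi(n), and this case is
    how unitaries of the commutant are recognised below. *)
Definition implements (s : G) (u : unitary H) :=
  forall n : N, (u * pi n = pi (ns_conj s n) * u)%g.

Lemma implementsM s t u w :
  implements s u -> implements t w -> implements (s * t)%g (u * w)%g.
Proof. by move=> su tw n; rewrite -mulgA tw mulgA su ns_conjM mulgA. Qed.

Lemma implementsV s u : implements s u -> implements s^-1%g u^-1%g.
Proof.
move=> su n; apply: (mulgI u); apply: (mulIg u).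
by rewrite !mulgA mulgV mul1g mulgVK su -ns_conjM mulgV ns_conj1.
Qed.

Fact implementers_closed : group_closed
  (fun p : G * unitary H => p \in [set p | implements p.1 p.2]).
Proof.
split; first by rewrite inE => n /=; rewrite ns_conj1 mul1g mulg1.
move=> [s u] [t v]; rewrite !inE /= => su tv.
exact: implementsM su (implementsV tv).
Qed.

Definition implementers : subgroup (G * unitary H)%type :=
  Subgroup implementers_closed.

Definition impl_pt (e : implementers) : G := (val e).1.
Definition impl_op (e : implementers) : unitary H := (val e).2.

Lemma impl_ptM : {morph impl_pt : x y / x * y >-> x * y}%g.
Proof. by []. Qed.

Lemma impl_opM : {morph impl_op : x y / x * y >-> x * y}%g.
Proof. by []. Qed.

Lemma implP (e : implementers) : implements (impl_pt e) (impl_op e).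
Proof. by have := valP e; rewrite inE. Qed.

Lemma impl_pt_continuous : continuous impl_pt.
Proof.
move=> e; apply: (@continuous_comp _ _ _ (val : implementers -> (G * unitary H)%type) fst).
- exact: sg_val_continuous.
- exact: cvg_fst.
Qed.

Lemma impl_op_continuous : continuous impl_op.
Proof.
move=> e; apply: (@continuous_comp _ _ _ (val : implementers -> (G * unitary H)%type) snd).
- exact: sg_val_continuous.
- exact: cvg_snd.
Qed.

Definition mk_impl (s : G) (u : unitary H) (su : implements s u) : implementers :=
  Sub (s, u) (mem_set su : (s, u) \in sg_set implementers).

Hypotheses (hG : hausdorff_space G) (sG : @second_countable G)
  (lcG : locally_compact [set: G]) (sH : separable H).
Hypotheses (pirep : unitary_representation pi) (piinv : invariant_rep pi).

Lemma implementers_set_closed : closed (sg_set implementers).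
Proof.
have -> : sg_set implementers = \bigcap_(n in [set: N])
    [set p : G * unitary H | (p.2 * pi n = pi (ns_conj p.1 n) * p.2)%g].
  by apply/seteqP; split=> p h n; [move=> _; exact: h|exact: h].
apply: closed_bigI => n _; apply: closed_equalizer.
- exact: unitary_hausdorff.
- move=> p; apply: (@continuous_comp _ _ _ snd (fun u : unitary H => (u * pi n)%g)).
    exact: cvg_snd.
  exact: mulgr_continuous.
- move=> p; apply: (@continuous_comp _ _ _
    (fun p : G * unitary H => (pi (ns_conj p.1 n), p.2))
    (fun q : unitary H * unitary H => (q.1 * q.2)%g)); last exact: mulg_continuous.
  apply: (@continuous_pair _ _ _ (fun p : G * unitary H => pi (ns_conj p.1 n)) snd).
    move=> q; apply: (@continuous_comp _ _ _ fst (fun s : G => pi (ns_conj s n))).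
      exact: cvg_fst.
    apply: (@continuous_comp _ _ _ (fun s : G => ns_conj s n) pi).
      exact: ns_conj_continuous.
    exact: pirep.1.
  by move=> q; exact: cvg_snd.
Qed.

Lemma implementers_polish : exists (b : nat -> set implementers)
    (small : nat -> set (set implementers)),
  countable_base b /\ complete_covers small.
Proof.
have [bG bGP] := second_countable_base sG.
have [sG' sGP] := locally_compact_complete_covers bGP lcG.
have [xs xsP] := separable_dense_seq sH.
have [d dP] := countable_base_prod bGP (unitary_countable_base xsP).
have [|small smallP] := complete_covers_nat (complete_covers_initial
    (h := val : set_type (sg_set implementers) -> _) _
    (complete_covers_prod sGP (unitary_complete_covers xsP))).
  rewrite (_ : _ @` _ = sg_set implementers); first exact: implementers_set_closed.
  apply/seteqP; split=> [_ [e _ <-]|p Sp]; first by have := valP e; rewrite inE.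
  by exists (Sub p (mem_set Sp)).
exists (fun n => val @^-1` d n), small; split=> //.
exact: (countable_base_initial (val : set_type (sg_set implementers) -> _) dP).
Qed.

Lemma group_baire : baire_space G.
Proof.
have [bG bGP] := second_countable_base sG.
have [small sP] := locally_compact_complete_covers bGP lcG.
exact: complete_covers_baire sP (@topGroup_regular G).
Qed.

Theorem implementing_section : closed (ns_set N) ->
  exists p : quotient_group N -> implementers,
    [/\ borel_map p, forall x, qmap N (impl_pt (p x)) = x & p 1%g = 1%g].
Proof.
move=> cN; have [b [small [bP sP]]] := implementers_polish.
have pt_surj s : exists e, impl_pt e = s.
  have [W WP] := piinv s.
  have sW : implements s W.
    move=> n; apply: unitary_ext; rewrite !unitary_opM WP.
    by rewrite -[RHS]mulrA unitary_Vmul mulr1.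
  by exists (mk_impl sW).
have pt_open := open_mapping impl_pt_continuous impl_ptM pt_surj bP sP group_baire hG.
have [|||p pb pK] := @borel_section _ _ (fun e => qmap N (impl_pt e)) _ _
    _ _ _ (quotient_hausdorff cN) (@topGroup_regular implementers) bP sP.
- move=> e; apply: (@continuous_comp _ _ _ impl_pt (qmap N)).
    exact: impl_pt_continuous.
  exact: qmap_continuous.
- move=> U oU; have := qmap_open N (pt_open U oU).
  by rewrite image_comp.
- move=> x; have [s <-] := qmap_surj x; have [e <-] := pt_surj s.
  by exists e.
(* Normalisation inside the group E: the first coordinate of [p 1] lies in N, so dividing by [p 1]
   keeps a section and sends the identity to the identity in both coordinates. *)
exists (fun x => p x / p 1%g)%g; split.
- apply: (borel_map_comp (g := fun e : implementers => (e / p 1%g)%g)) pb _.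
  by apply: continuous_borel_map; exact: mulgr_continuous.
- move=> x; rewrite impl_ptM qmapM pK.
  have -> : qmap N (impl_pt (p 1)^-1)%g = 1%g; last by rewrite mulg1.
  apply: (mulgI (qmap N (impl_pt (p 1%g)))); rewrite -qmapM.
  by rewrite -impl_ptM mulgV mulg1 pK.
- by rewrite mulgV.
Qed.

End ImplementingGroup.

(** * The ultraweak topology and the u-topology *)

Section ComplexComplete.
Context (R : realType).
Implicit Types (z w : R[i]).

Lemma norm_le_ReIm z : `|z| <= (`|complex.Re z| + `|complex.Im z|)%:C%C.
Proof.
rewrite {1}[z]complexE; apply: le_trans (ler_normD _ _) _.
rewrite normrM rmorphD /=; apply: lerD.
- by rewrite normc_def /= expr0n addr0 sqrtr_sqr.
- have -> : `|'i%C : R[i]| = 1 by rewrite normc_def /= expr0n expr1n add0r sqrtr1.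
  by rewrite mul1r normc_def /= expr0n addr0 sqrtr_sqr.
Qed.

Lemma normc_ge_Im z : `|complex.Im z|%:C%C <= `|z|.
Proof.
rewrite normc_def lecE /= eqxx /= -sqrtr_sqr ler_wsqrtr // lerDr sqr_ge0 //.
Qed.

(** Re and Im are additive and 1-Lipschitz, which reduces the claim to completeness of [R]. *)
Lemma complex_cauchy_cvg (F : set_system R[i]^o) :
  ProperFilter F -> cauchy F -> exists z : R[i]^o, F --> z.
Proof.
move=> PF /cauchyP Fc.
have part (h : R[i] -> R) : (forall z w, h (z - w) = h z - h w) ->
    (forall z, `|h z|%:C%C <= `|z|) -> exists a : R, h @ F --> a.
  move=> hB hn.
  have PF' : ProperFilter (h @ F) by exact: fmap_proper_filter.
  suff : cvg (h @ F) by move=> /cvg_ex[a Fa]; exists a.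
  apply: cauchy_cvg; apply: cauchy_exP => e e0.
  have e0' : 0 < e%:C%C :> R[i] by rewrite ltcR.
  have [z Fz] := Fc _ e0'; exists (h z).
  suff : F [set w | ball (h z) e (h w)] by [].
  apply: filterS Fz => w; rewrite -!ball_normE /= => zw.
  by rewrite -hB -ltcR; exact: le_lt_trans (hn _) zw.
have [a Fa] := part (@complex.Re R) (raddfB _) (@normc_ge_Re R).
have [b Fb] := part (@complex.Im R) (raddfB _) normc_ge_Im.
exists (a +i* b)%C; apply: (iffRL (@cvgrPdist_lt _ R[i]^o _ F _ id _)) => e e0.
have eE : e = (complex.Re e)%:C%C.
  by move: e0; rewrite ltcE /= => /andP[/eqP b0 _]; case: e b0 => ? ? /= ->.
have e2 : 0 < complex.Re e / 2.
  by rewrite divr_gt0 //; move: e0; rewrite ltcE => /andP[].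
have FA : F [set z | `|a - complex.Re z| < complex.Re e / 2].
  by have /cvgrPdist_lt := Fa; apply.
have FB : F [set z | `|b - complex.Im z| < complex.Re e / 2].
  by have /cvgrPdist_lt := Fb; apply.
apply: filterS (filterI FA FB) => z [/= az bz].
apply: le_lt_trans (norm_le_ReIm _) _; rewrite eE ltcR [X in _ < X]splitr.
by rewrite !raddfB /= ltrD.
Qed.
End ComplexComplete.

Section DominatedSeries.
Context (R : realType) (H : hilbertType R).
Implicit Types (x y : nat -> H) (c : nat -> R[i]^o).

(** The point is that N depends on x, y and e but not on c: 2|x_n||y_n| <= |x_n|^2 + |y_n|^2 bounds
    all tails at once. The factor 2 leaves room for differences of two contractions. *)
Lemma dominated_series x y (e : R[i]) :
  sqsummable x -> sqsummable y -> 0 < e ->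
  exists N : nat, forall c, (forall n, `|c n| <= 2 * (`|x n| * `|y n|)) ->
    cvgn (series c) /\ `|limn (series c) - series c N| <= e.
Proof.
move=> sx sy e0.
have tail (e' : R[i]) : 0 < e' -> exists N : nat, forall c,
    (forall n, `|c n| <= 2 * (`|x n| * `|y n|)) ->
    forall n m, (N <= n)%N -> (N <= m)%N -> `|series c m - series c n| <= e'.
  move=> e0'; have e2 : 0 < e' / 2 by rewrite divr_gt0.
  have [[A A'] /= [[N1 _ N1A] [N2 _ N2A]] hx] :=
    iffLR (cauchy_seriesP _) (cvg_cauchy _ sx) _ e2.
  have [[B B'] /= [[N3 _ N3B] [N4 _ N4B]] hy] :=
    iffLR (cauchy_seriesP _) (cvg_cauchy _ sy) _ e2.
  exists (maxn (maxn N1 N2) (maxn N3 N4)) => c cxy n m Nn Nm.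
  wlog nm : n m Nn Nm / (n <= m)%N => [wl|].
    by have [/wl|/ltnW/wl] := leqP n m; [apply|rewrite distrC; apply].
  move: Nn Nm; rewrite !geq_max => /andP[/andP[n1 n2] /andP[n3 n4]].
  move=> /andP[/andP[m1 m2] /andP[m3 m4]].
  have {}hx : `|\sum_(n <= k < m) `|x k| ^+ 2| < e' / 2.
    by apply: (hx (n, m)); split; [exact: N1A|exact: N2A].
  have {}hy : `|\sum_(n <= k < m) `|y k| ^+ 2| < e' / 2.
    by apply: (hy (n, m)); split; [exact: N3B|exact: N4B].
  rewrite sub_series_geq //; apply: le_trans (ler_norm_sum _ _ _) _.
  apply: (@le_trans _ _ (\sum_(n <= k < m) (`|x k| ^+ 2 + `|y k| ^+ 2))).
    apply: ler_sum => k _; apply: le_trans (cxy k) _; rewrite -subr_ge0.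
    have -> : `|x k| ^+ 2 + `|y k| ^+ 2 - 2 * (`|x k| * `|y k|) =
      (`|x k| - `|y k|) ^+ 2 by ring.
    by apply: real_exprn_even_ge0 => //; rewrite realB // normr_real.
  rewrite big_split /= (splitr e').
  apply: lerD; apply: le_trans (ltW _); [|exact: hx| |exact: hy].
  - by rewrite ger0_norm // sumr_ge0.
  - by rewrite ger0_norm // sumr_ge0.
have [N NP] := tail _ (divr_gt0 e0 (ltr0Sn _ 1)).
exists N => c cxy; have [z cz] : exists z : R[i]^o, series c @ \oo --> z.
  apply: complex_cauchy_cvg; apply: cauchy_exP => d d0.
  have [M MP] := tail _ (divr_gt0 d0 (ltr0Sn _ 1)); exists (series c M).
  exists M => // m /= Mm; rewrite -ball_normE /=.
  rewrite distrC; apply: le_lt_trans (MP c cxy M m (leqnn M) Mm) _.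
  by rewrite ltr_pdivrMr // ltr_pMr // ltr1n.
split; first by apply/cvg_ex; exists z.
rewrite (cvg_lim _ cz) //.
have [m [/= Nm zm]] : exists m, (N <= m)%N /\ `|z - series c m| <= e / 2.
  apply: (@filter_ex _ \oo); apply: filterI; first by exists N.
  by have /cvgrPdist_le := cz; apply; rewrite divr_gt0.
rewrite -(subrKA (series c m)) (splitr e); apply: le_trans (ler_normD _ _) _.
by apply: lerD => //; exact: NP.
Qed.

(** Dominated convergence for series, along a filter and uniformly in a parameter i:
    [dominated_series] fixes a common cut-off, and the finite sum before it is handled by induction.
    The parameter will range over the unit ball of the algebra. *)
Lemma dominated_limit (Z I : Type) (D : set I) (F : set_system Z) x y
    (c : Z -> I -> nat -> R[i]^o) :
  Filter F -> sqsummable x -> sqsummable y ->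
  (forall z i n, D i -> `|c z i n| <= 2 * (`|x n| * `|y n|)) ->
  (forall n (e : R[i]), 0 < e -> F [set z | forall i, D i -> `|c z i n| <= e]) ->
  forall e : R[i], 0 < e ->
    F [set z | forall i, D i -> `|limn (series (c z i))| <= e].
Proof.
move=> FF sx sy cxy c0 e e0; have e2 : 0 < e / 2 by rewrite divr_gt0.
have [N NP] := dominated_series sx sy e2.
have part k (d : R[i]) : 0 < d ->
    F [set z | forall i, D i -> `|series (c z i) k| <= d].
  elim: k d => [|k IH] d d0.
    apply: filterE => z i Di.
    by rewrite /series /= big_geq // normr0 ltW.
  have d2 : 0 < d / 2 by rewrite divr_gt0.
  apply: filterS (filterI (IH _ d2) (c0 k _ d2)) => z [sz cz] i Di.
  rewrite /series /= big_nat_recr //= (splitr d).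
  by apply: le_trans (ler_normD _ _) _; apply: lerD; [exact: sz|exact: cz].
apply: filterS (part N _ e2) => z sz i Di.
have [_ lN] := NP (c z i) (fun n => cxy z i n Di).
rewrite -[limn _](subrK (series (c z i) N)) (splitr e).
by apply: le_trans (ler_normD _ _) _; apply: lerD => //; exact: sz.
Qed.

End DominatedSeries.

Section Ultraweak.
Context (R : realType) (H : hilbertType R).
Implicit Types (a b : bop H) (x y : nat -> H).

Definition contractive_op a := forall x : H, `|a x| <= `|x|.

Lemma bop_subE a b (x : H) : (a - b) x = a x - b x.
Proof. by rewrite /= scaleN1r. Qed.

Lemma contractive_unitary (u : unitary H) : contractive_op u.
Proof. by move=> x; rewrite norm_unitary. Qed.

Lemma contractive_hdotB a b (x y : H) : contractive_op a -> contractive_op b ->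
  `|hdot (a x - b x) y| <= 2 * (`|x| * `|y|).
Proof.
move=> ca cb; apply: le_trans (norm_hdot _ _) _; rewrite mulrA ler_wpM2r //.
rewrite mulr_natl mulr2n; apply: le_trans (ler_normB _ _) _.
by apply: lerD.
Qed.

Lemma ultraweak_evalB a b p : contractive_op a -> contractive_op b ->
  ultraweak_eval a p - ultraweak_eval b p =
  limn (series (fun n => hdot (a ((val p).1 n) - b ((val p).1 n)) ((val p).2 n) : R[i]^o)).
Proof.
move=> ca cb; have /set_mem[sx sy] := valP p.
have cv c : contractive_op c ->
    cvgn (series (fun n => hdot (c ((val p).1 n)) ((val p).2 n) : R[i]^o)).
  move=> cc; have [N NP] := dominated_series sx sy (@ltr01 R[i]).
  apply: (NP _ _).1 => n; apply: le_trans (norm_hdot _ _) _.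
  by rewrite mulrA ler_wpM2r // (le_trans (cc _)) // ler_peMl // ler1n.
rewrite /ultraweak_eval -(limB (cv a ca) (cv b cb)).
set f := _ - _; set g := series _; suff -> : f = g by [].
apply/funext => n; rewrite /f /g /series /= -[LHS]sumrB; apply: eq_bigr => k _.
by rewrite linearBl.
Qed.

Lemma cvg_ultraweak (Z : Type) (F : set_system Z) (g : Z -> bop H) a :
  Filter F ->
  (forall p, (fun z => ultraweak_eval (g z) p : R[i]^o) @ F --> (ultraweak_eval a p : R[i]^o)) ->
  g @ F --> a.
Proof.
move=> FF gp A; rewrite nbhsE => -[_ [[B oB <-] Ba] BA].
have hF : (fun z => ultraweak_eval (g z)) @ F --> ultraweak_eval a.
  apply/cvg_sup => p W; rewrite nbhsE => -[_ [[V oV <-] Vu] VW].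
  apply: (filterS VW); apply: (gp p V).
  exact: open_nbhs_nbhs.
apply: (filterS BA); apply: (hF B).
exact: (@open_nbhs_nbhs _ (ultraweak_eval a) B (conj oB Ba)).
Qed.

Lemma unitary_ultraweak_continuous : continuous (fun u : unitary H => unitary_op u).
Proof.
move=> u; apply: (@cvg_ultraweak _ (nbhs u) _ _ (nbhs_filter u)) => p; have /set_mem[sx sy] := valP p.
apply: (iffRL (@cvgrPdist_le _ R[i]^o _ (nbhs u) (nbhs_filter u)
  (fun v : unitary H => ultraweak_eval v p) (ultraweak_eval u p))) => e e0.
pose c (v : unitary H) (_ : unit) n : R[i]^o :=
  hdot (unitary_op u ((val p).1 n) - unitary_op v ((val p).1 n)) ((val p).2 n).
have : nbhs u [set v | forall i, [set: unit] i -> `|limn (series (c v i))| <= e].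
  apply: (@dominated_limit R H _ _ _ (nbhs u) _ _ _ (nbhs_filter u) sx sy) => //.
    by move=> v i n _; apply: contractive_hdotB; exact: contractive_unitary.
  move=> n d d0.
  have y0 : 0 < `|(val p).2 n| + 1 by rewrite ltr_wpDl.
  apply: filterS (unitary_eval_near u ((val p).1 n) (divr_gt0 d0 y0)) => v /= uv i _.
  apply: le_trans (norm_hdot _ _) _.
  apply: (@le_trans _ _ (d / (`|(val p).2 n| + 1) * (`|(val p).2 n| + 1))).
    by apply: ler_pM => //; [exact: ltW|rewrite lerDl].
  by rewrite divfK // gt_eqF.
apply: filterS => v /= /(_ tt Logic.I).
by rewrite ultraweak_evalB //; exact: contractive_unitary.
Qed.

End Ultraweak.

Section VnUnitary.
Context (R : realType) (H : hilbertType R) (A : vnAlg H).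
Implicit Types (v w : vnUnitary A) (a : A).

Lemma vnu_ext v w : vnu_elt v = vnu_elt w -> v = w.
Proof.
case: v w => [v v' vv' v1 v2] [w w' ww' w1 w2] /= vw.
rewrite -vw in ww' w1 w2 *.
have v'w' : v' = w' by apply: val_inj; exact: adjoint_inj vv' ww'.
by rewrite -v'w' in ww' w1 w2 *; congr VnUnitary; exact: Prop_irrelevance.
Qed.

Definition vnu_unitary v : unitary H :=
  Unitary (vnu_adj v) (congr1 val (vnu_mulV v)) (congr1 val (vnu_Vmul v)).

(** This is how Borel measurability, obtained in U(H) with the strong topology, is transported to
    the unitaries of the algebra with the ultraweak one. *)
Lemma vnu_openP (B : set (vnUnitary A)) : open B ->
  exists2 O : set (unitary H), open O & B = vnu_unitary @^-1` O.
Proof.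
move=> [_ [_ [C oC <-] <-] <-].
exists ((fun u : unitary H => unitary_op u) @^-1` (@ultraweak_eval R H @^-1` C)) => //.
by have /continuousP := @unitary_ultraweak_continuous _ H; apply; exists C.
Qed.

Lemma vnu_borel (Z : topologicalType) (f : Z -> vnUnitary A) :
  borel_map (fun z => vnu_unitary (f z)) -> borel_map f.
Proof.
move=> bf; apply: borel_map_openP => B /vnu_openP[U oU ->].
exact: (bf U (borel_open oU)).
Qed.

End VnUnitary.

Section VnUnitaryContinuous.
Context (R : realType) (H : hilbertType R) (A : vnAlg H).

(** Sequences with one nonzero term realise the vector functionals a |-> <a x, y> among the
    ultraweak evaluations. *)
Let single (x : H) (n : nat) : H := if n is 0%N then x else 0.

Let series_single (c : nat -> R[i]^o) : (forall n, c n.+1 = 0) ->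
  series c @ \oo --> c 0%N.
Proof.
move=> c0; apply: cvg_near_cst; exists 1%N => // -[//|n] _.
by rewrite /series /= big_nat_recl //= big1 ?addr0 // => k _; exact: c0.
Qed.

Let sqsummable_single x : sqsummable (single x).
Proof.
apply/cvg_ex; exists (`|x| ^+ 2).
by apply: (@series_single (fun n => `|single x n| ^+ 2)) => n /=; rewrite normr0 expr0n.
Qed.

Lemma hdot_ultraweak_continuous (x y : H) :
  continuous (fun a : bop H => hdot (a x) y : R[i]^o).
Proof.
have sxy : sqsummable (single x) /\ sqsummable (single y).
  by split; apply: sqsummable_single.
pose p : set_type [set p : (nat -> H) * (nat -> H) | sqsummable p.1 /\ sqsummable p.2] :=
  Sub (single x, single y) (mem_set sxy).
have -> : (fun a : bop H => hdot (a x) y : R[i]^o) = (fun a => ultraweak_eval a p).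
  apply/funext => a; apply/esym; rewrite /ultraweak_eval.
  rewrite (cvg_lim _ (series_single (c := fun n => hdot (a (single x n)) (single y n)) _)) //.
  by move=> n /=; rewrite linear0r.
move=> a; apply: (@continuous_comp _ _ _ (@ultraweak_eval R H) (fun f : {ptws _ -> R[i]^o} => f p)).
  exact: (@initial_continuous (bop H) _ (@ultraweak_eval R H)).
exact: (@proj_continuous _ (fun=> R[i]^o) p).
Qed.

(** As v and w are isometric, |v x - w x|^2 = 2 Re(<v x, v x> - <w x, v x>), so weak closeness on
    one pair of vectors forces strong closeness. *)
Lemma vnu_unitary_continuous : continuous (@vnu_unitary R H A).
Proof.
apply/continuous_unitary => x v.
apply: (iffRL (@cvgrPdist_lt _ H _ (nbhs v) (nbhs_filter v)
  (fun w => vnu_unitary w x) (vnu_unitary v x))) => e e0.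
have e2 : 0 < e ^+ 2 / 2 by rewrite divr_gt0 // exprn_gt0.
have cw : continuous (fun w : vnUnitary A => hdot (vnu_unitary w x) (vnu_unitary v x) : R[i]^o).
  move=> w; apply: (@continuous_comp _ _ _ (fun w : vnUnitary A => val (vnu_elt w))
    (fun a : bop H => hdot (a x) (vnu_unitary v x) : R[i]^o)); last first.
    exact: hdot_ultraweak_continuous.
  apply: (@continuous_comp _ _ _ (@vnu_elt R H A) (val : vn_sort A -> bop H)).
    exact: (@initial_continuous (vnUnitary A) _ (@vnu_elt R H A)).
  exact: (@initial_continuous (set_type (vn_set A)) _ set_val).
have /cvgrPdist_lt/(_ _ e2) := cw v.
apply: filterS => w /= vw.
rewrite -(@ltr_pXn2r _ 2) ?nnegrE ?normr_ge0 ?(ltW e0) //.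
have := exprn_ge0 2 (normr_ge0 (vnu_unitary v x - vnu_unitary w x)).
move=> /ger0_norm <-.
have -> : `|vnu_unitary v x - vnu_unitary w x| ^+ 2 =
    (hdot (vnu_unitary v x) (vnu_unitary v x) - hdot (vnu_unitary w x) (vnu_unitary v x)) +
    (hdot (vnu_unitary v x) (vnu_unitary v x) - hdot (vnu_unitary w x) (vnu_unitary v x))^*.
  rewrite -hdotE linearBl !linearBr /= rmorphB /= -!hdotC.
  have -> : hdot (vnu_unitary w x) (vnu_unitary w x) = hdot (vnu_unitary v x) (vnu_unitary v x).
    by rewrite !hdotE !norm_unitary.
  by ring.
rewrite (splitr (e ^+ 2)); apply: le_lt_trans (ler_normD _ _) _.
by rewrite norm_conjC ltrD.
Qed.

End VnUnitaryContinuous.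

Section VnAutTopology.
Context (R : realType) (H : hilbertType R) (A : vnAlg H).
Implicit Types (a : A) (f : predual A).

Lemma pd_sub f a b : f (a - b) = f a - f b.
Proof.
have := pd_linear f (-1) b a.
by rewrite !scaleN1r ![- _ + _]addrC.
Qed.

Lemma pd0 f : f 0 = 0.
Proof. by have := pd_sub f 0 0; rewrite !subrr. Qed.

Lemma functional_norm_le (g : A -> R[i]^o) (e : R) :
  (forall a, vn_unit_ball a -> `|g a| <= e%:C%C) ->
  (functional_norm g <= e%:E)%E.
Proof.
move=> ge; apply: ge_ereal_sup => _ [a aB <-]; rewrite lee_fin.
by have := ge a aB; rewrite lecE => /andP[].
Qed.

Lemma le_functional_norm (g : A -> R[i]^o) (e : R) a :
  (functional_norm g <= e%:E)%E -> vn_unit_ball a -> `|g a| <= e%:C%C.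
Proof.
move=> ge aB.
have : ((complex.Re `|g a|)%:E <= e%:E)%E.
  by apply: le_trans ge; apply: ereal_sup_ubound; exists a.
by rewrite lee_fin normc_def lecR.
Qed.

(* A predual functional is continuous at 0, so it is uniformly small on the
   differences [alpha z a - alpha z0 a], [a] in the unit ball, as soon as these
   tend to 0 ultraweakly and uniformly in [a]. *)
Lemma implemented_predual_near (Z : topologicalType) (u : Z -> unitary H)
    (alpha : Z -> vnAut A) (z0 : Z) f (e : R[i]) :
  continuous u ->
  (forall z a, val (alpha z a) =
    unitary_op (u z) * val a * unitary_star (u z)) -> 0 < e ->
  nbhs z0 [set z | forall a, vn_unit_ball a ->
    `|f (alpha z a) - f (alpha z0 a)| <= e].
Proof.
move=> cu alphaE e0.
have alpha_contr z a : vn_unit_ball a -> contractive_op (val (alpha z a)).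
  by move=> aB x; rewrite alphaE /= norm_unitary (le_trans (aB _)) // norm_unitary_star.
(* Convergence of F to 0 encodes ultraweak convergence of the differences uniformly in a. Continuity
   of f at 0 then yields the uniform estimate directly. *)
pose F : set_system A := [set S | nbhs z0 [set z | forall a, vn_unit_ball a ->
  S (alpha z a - alpha z0 a)]].
have FF : Filter F.
  split=> [|P Q FP FQ|P Q PQ FP].
  - by apply: (@filterS _ (nbhs z0) _ setT) => [z _ a _ //|]; exact: filterT.
  - apply: (@filterS _ (nbhs z0) _ _ _ _ (@filterI _ (nbhs z0) _ _ _ FP FQ)) => z [Pz Qz] a aB.
    by split; [exact: Pz|exact: Qz].
  - by apply: (@filterS _ (nbhs z0) _ _ _ _ FP) => z Pz a aB; apply: PQ; exact: Pz.
have star_near x (d : R[i]) : 0 < d ->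
    nbhs z0 [set z | `|unitary_star (u z0) x - unitary_star (u z) x| < d].
  move=> d0; apply: (cu z0 [set v | `|unitary_star (u z0) x - unitary_star v x| < d]).
  exact: (@invg_continuous (unitary H) (u z0) _ (unitary_eval_near (unitary_inv (u z0)) x d0)).
have F0 : F --> (0 : A).
  have vF : (fun s : A => (val s : bop H)) @ F --> (0 : bop H).
    apply: (@cvg_ultraweak R H _ F _ _ FF) => p; have /set_mem[sx sy] := valP p.
    apply: (iffRL (@cvgrPdist_le _ R[i]^o _ F FF _ _)) => d d0.
    pose c (z : Z) a n : R[i]^o :=
      hdot ((val (alpha z a) : bop H) ((val p).1 n) - (val (alpha z0 a) : bop H) ((val p).1 n)) ((val p).2 n).
    have : nbhs z0 [set z | forall a, vn_unit_ball a -> `|limn (series (c z a))| <= d].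
      apply: (@dominated_limit R H _ _ _ (nbhs z0) _ _ _ (nbhs_filter z0) sx sy) => //.
        by move=> z a n aB; apply: contractive_hdotB; exact: alpha_contr.
      move=> n e1 e10; set x := (val p).1 n; set y := (val p).2 n.
      have s0 : 0 < `|x| + `|y| + 1 by rewrite ltr_wpDl // addr_ge0.
      apply: (@filterS _ (nbhs z0) _ _ _ _ (@filterI _ (nbhs z0) _ _ _
        (star_near x _ (divr_gt0 e10 s0)) (star_near y _ (divr_gt0 e10 s0)))).
      move=> z [/= zx zy] a aB.
      (* The unitaries are moved onto the vectors x and y, leaving a difference of adjoints in each
         term. As a is contractive, the bound does not depend on a. *)
      have -> : c z a n =
          hdot ((val a : bop H) (unitary_star (u z) x - unitary_star (u z0) x)) (unitary_star (u z) y) +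
          hdot ((val a : bop H) (unitary_star (u z0) x)) (unitary_star (u z) y - unitary_star (u z0) y).
        rewrite /c -/x -/y !alphaE linearBl linearBr /= !unitary_adj bopB linearBl.
        by rewrite addrA subrK.
      apply: le_trans (ler_normD _ _) _.
      apply: (@le_trans _ _ (e1 / (`|x| + `|y| + 1) * (`|y| + `|x|))).
        rewrite mulrDr; apply: lerD; apply: le_trans (norm_hdot _ _) _.
        - rewrite norm_unitary_star ler_wpM2r // (le_trans (aB _)) //.
          by rewrite distrC ltW.
        - rewrite mulrC distrC; apply: ler_pM => //; first exact: ltW.
          by rewrite (le_trans (aB _)) // norm_unitary_star.
      by rewrite mulrAC ler_pdivrMr // ler_pM2l // addrC lerDl.
    apply: filterS => z cz a aB /=.
    have -> : ultraweak_eval (0 : bop H) p = 0.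
      rewrite /ultraweak_eval (_ : series _ = fun=> 0) ?lim_cst //.
      by apply/funext => n; rewrite /series /= big1 // => k _; rewrite linear0l.
    have -> : ultraweak_eval (val (alpha z a - alpha z0 a)) p = limn (series (c z a)).
      rewrite /ultraweak_eval; set h := (fun n => hdot _ _).
      suff -> : h = c z a by [].
      by apply/funext => n; rewrite /h /c -bop_subE.
    by rewrite sub0r normrN; exact: cz.
  move=> S; rewrite nbhsE => -[_ [[B oB <-] B0] BS].
  apply: (filterS BS); apply: (vF B); exact: open_nbhs_nbhs.
have fF : (f : A -> R[i]^o) @ F --> (f 0 : R[i]^o).
  by apply: (@cvg_comp _ _ _ (id : A -> A) f F (nbhs (0 : A))) F0 _; exact: pd_continuous.
rewrite pd0 in fF.
have fz := iffLR (@cvgr0Pnorm_le _ R[i]^o _ F FF f) fF e e0.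
apply: (@filterS _ (nbhs z0) _ _ _ _ (fz : F _)) => z hz a aB.
by rewrite -pd_sub; exact: hz.
Qed.

(** It suffices to treat subbasic balls. Such a ball is centred at an arbitrary phi rather than at
    [alpha z0], so the strict inequality at z0 has to provide the margin. *)
Lemma implemented_continuous (Z : topologicalType) (u : Z -> unitary H)
    (alpha : Z -> vnAut A) :
  continuous u ->
  (forall z a, val (alpha z a) =
    unitary_op (u z) * val a * unitary_star (u z)) -> continuous alpha.
Proof.
move=> cu alphaE z0 S; rewrite nbhsE => -[_ [[B sB <-] [C BC Cz]] CS].
apply: (@filterS _ (nbhs z0) _ (alpha @^-1` C)).
  by move=> z Cz'; apply: CS; exists C.
have [D sD IDeC] := sB _ BC; rewrite -IDeC in Cz *.
rewrite preimage_bigcap; apply: (@filter_bigI _ _ D _ (nbhs z0) _) => E DE.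
have /set_mem[phi [f [e [e0 EE]]]] := sD _ DE.
have : uball phi f e (alpha z0) by rewrite -EE; exact: Cz.
rewrite EE /uball /=.
set g0 := functional_norm _ => g0e.
(* Testing on a = 0 excludes the value minus infinity, so the norm [g0], already below e, is a real
   number r. *)
have g00 : (0 <= g0)%E.
  apply: ereal_sup_ubound; exists 0; first by move=> x /=; rewrite normr0.
  have -> : forall psi : vnAut A, psi 0 = 0.
    move=> psi; have := vna_linear psi (-1) 0 0.
    by rewrite scaler0 addr0 scaleN1r addNr.
  have -> : phi 0 = 0.
    have := vna_linear phi (-1) 0 0.
    by rewrite scaler0 addr0 scaleN1r addNr.
  by rewrite subrr normr0.
have g0fin : g0 \is a fin_num by rewrite ge0_fin_numE // (lt_le_trans g0e) // leey.
have g0E := fineK g0fin; set r := fine g0 in g0E.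
have re : r < e by rewrite -lte_fin g0E.
have d0 : 0 < (e - r) / 2 by rewrite divr_gt0 // subr_gt0.
have d0' : 0 < ((e - r) / 2)%:C%C :> R[i] by rewrite ltcR.
have fz0 := implemented_predual_near z0 f cu alphaE d0'.
apply: (@filterS _ (nbhs z0) _ _ _ _ fz0) => z fz.
apply: (@le_lt_trans _ _ ((e - r) / 2 + r)%:E).
  apply: functional_norm_le => a aB.
  rewrite -(subrKA (f (alpha z0 a))) rmorphD; apply: le_trans (ler_normD _ _) _.
  apply: lerD; first exact: fz.
  by apply: (le_functional_norm (g := fun a => f (alpha z0 a) - f (phi a))) => //; rewrite g0E.
by rewrite lte_fin; lra.
Qed.

End VnAutTopology.

(** * The twisted action *)

Lemma borel_mulg (X : topologicalType) (K : topGroupType) (b : nat -> set K)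
    (f g : X -> K) :
  countable_base b -> borel_map f -> borel_map g ->
  borel_map (fun x => f x * g x)%g.
Proof.
move=> bK bf bg.
apply: (borel_map_comp (f := fun x => (f x, g x)) (g := fun p : K * K => (p.1 * p.2)%g)).
  exact: (borel_map_pair bK bK bf bg).
by apply: continuous_borel_map; exact: mulg_continuous.
Qed.

Lemma borel_invg (X : topologicalType) (K : topGroupType) (f : X -> K) :
  borel_map f -> borel_map (fun x => (f x)^-1)%g.
Proof.
move=> bf; apply: (borel_map_comp (g := fun x : K => x^-1%g)) => //.
by apply: continuous_borel_map; exact: invg_continuous.
Qed.

Section Commutant.
Context (G : topGroupType) (N : normalSubgroup G) (R : realType)
  (H : hilbertType R) (pi : N -> unitary H).
Local Notation A := (rep_commutant pi).
Implicit Types (a : A) (u : unitary H) (v : vnUnitary A) (e : implementers pi).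

Lemma commutantP (T : bop H) :
  vn_set A T <-> forall n, unitary_op (pi n) * T = T * unitary_op (pi n).
Proof.
split=> [AT n|AT]; last by move=> _ [n _ <-]; exact: AT.
by apply: (AT : rep_commutant_set pi T); exists n.
Qed.

Lemma commutant_comm a n :
  unitary_op (pi n) * val a = val a * unitary_op (pi n).
Proof. by have := valP a; rewrite inE => /commutantP; apply. Qed.

Definition conj_op u (T : bop H) : bop H :=
  unitary_op u * T * unitary_op u^-1%g.

Lemma conj_opM u w T : conj_op (u * w)%g T = conj_op u (conj_op w T).
Proof. by rewrite /conj_op invgM /= !mulrA. Qed.

Lemma conj_op1 T : conj_op 1%g T = T.
Proof. by rewrite /conj_op invg1 mul1r mulr1. Qed.

Lemma conj_op_pi n a : conj_op (pi n) (val a) = val a.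
Proof. by rewrite /conj_op commutant_comm -mulrA unitary_mulV mulr1. Qed.

Lemma conj_op_piV n a : conj_op (pi n)^-1%g (val a) = val a.
Proof. by rewrite -{1}(conj_op_pi n a) -conj_opM mulVg conj_op1. Qed.

(** An implementing unitary u permutes the operators pi(n) by conjugation, hence conjugation by u
    preserves their commutant. *)
Fact impl_aut_subproof e a : conj_op (impl_op e) (val a) \in vn_set A.
Proof.
rewrite inE; apply/commutantP => n; set u := impl_op e.
have nu : (pi n * u = u * pi (ns_conj (impl_pt e)^-1%g n))%g.
  by rewrite implP -ns_conjM mulgV ns_conj1.
have un : (u^-1 * pi n = pi (ns_conj (impl_pt e)^-1%g n) * u^-1)%g.
  by apply: (mulgI u); apply: (mulIg u); rewrite !mulgA mulgV mul1g mulgVK -nu.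
rewrite /conj_op !mulrA -[in LHS]unitary_opM nu unitary_opM.
rewrite -(mulrA (unitary_op u)) commutant_comm -!mulrA.
by rewrite -[in RHS]unitary_opM un unitary_opM.
Qed.

Definition impl_aut_fun e a : A :=
  Sub (conj_op (impl_op e) (val a)) (impl_aut_subproof e a).

Fact impl_aut_linear e : linear (impl_aut_fun e).
Proof.
move=> c a b; apply: val_inj; apply: bopP => x /=.
by rewrite !bop_linear.
Qed.

Fact impl_aut_mul e : {morph impl_aut_fun e : a b / a * b}.
Proof.
move=> a b; apply: val_inj; apply: bopP => x /=.
by rewrite unitary_starK.
Qed.

Fact impl_aut_star e a b : is_adjoint (val a) (val b) ->
  is_adjoint (val (impl_aut_fun e a)) (val (impl_aut_fun e b)).
Proof.
move=> ab x y /=; rewrite unitary_adj ab.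
exact: (is_adjoint_sym (unitary_adj (impl_op e))).
Qed.

Fact impl_aut_bij e : bijective (impl_aut_fun e).
Proof.
exists (impl_aut_fun e^-1%g) => a; apply: val_inj => /=.
- by rewrite -conj_opM -impl_opM mulVg conj_op1.
- by rewrite -conj_opM -impl_opM mulgV conj_op1.
Qed.

Definition impl_aut e : vnAut A :=
  VnAut (impl_aut_linear e) (impl_aut_mul e) (impl_aut_star e) (impl_aut_bij e).

Lemma impl_autE e a : val (impl_aut e a) = conj_op (impl_op e) (val a).
Proof. by []. Qed.

Lemma vna_ext (phi psi : vnAut A) : (forall a, phi a = psi a) -> phi = psi.
Proof.
case: phi psi => [f f1 f2 f3 f4] [g g1 g2 g3 g4] /= /funext fg.
rewrite fg in f1 f2 f3 f4 *.
by congr VnAut; exact: Prop_irrelevance.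
Qed.

Lemma impl_aut_continuous : continuous impl_aut.
Proof. exact: (implemented_continuous (@impl_op_continuous _ _ _ _ pi)). Qed.

Fact vnu_of_subproof u : implements pi 1%g u -> unitary_op u \in vn_set A.
Proof.
move=> cu; rewrite inE; apply/commutantP => n.
by rewrite -!unitary_opM cu ns_conj1.
Qed.

Lemma implements1V u : implements pi 1%g u -> implements pi 1%g u^-1%g.
Proof. by move=> /implementsV; rewrite invg1. Qed.

Fact vn_mul_eq1 (a b : A) : (val a : bop H) * val b = 1 -> a * b = 1.
Proof. by move=> ab; exact: val_inj. Qed.

(** Made total, with value 1 off the commutant, so that cocycles can be defined by a plain formula
    and the membership proof supplied afterwards through [vnu_ofK]. *)
Definition vnu_of u : vnUnitary A :=
  if pselect (implements pi 1%g u) is left cu then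
    let a : A := Sub (unitary_op u) (vnu_of_subproof cu) in
    let b : A := Sub (unitary_op u^-1%g) (vnu_of_subproof (implements1V cu)) in
    @VnUnitary _ _ A a b (unitary_adj u)
      (@vn_mul_eq1 a b (unitary_mulV u)) (@vn_mul_eq1 b a (unitary_Vmul u))
  else vnu1 A.

Lemma vnu_ofK u : implements pi 1%g u -> vnu_unitary (vnu_of u) = u.
Proof.
by move=> cu; apply: unitary_ext; rewrite /vnu_of; case: pselect.
Qed.

Lemma vnu_unitary_inj : injective (@vnu_unitary R H A).
Proof.
move=> v w vw; apply: vnu_ext; apply: val_inj.
exact: (congr1 (@unitary_op R H) vw).
Qed.

Lemma vnu_comm v n : (pi n * vnu_unitary v = vnu_unitary v * pi n)%g.
Proof. by apply: unitary_ext; exact: commutant_comm. Qed.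

End Commutant.

Section TwistedActionOfRep.
Context (G : topGroupType) (N : normalSubgroup G) (R : realType)
  (H : hilbertType R) (pi : N -> unitary H).
Hypotheses (sG : @second_countable G) (lcG : locally_compact [set: G])
  (sH : separable H) (pirep : unitary_representation pi).
Variable p : quotient_group N -> implementers pi.
Hypotheses (p_borel : borel_map p) (p_section : forall x, qmap N (impl_pt (p x)) = x)
  (p1 : p 1%g = 1%g).
Local Notation K := (quotient_group N).
Local Notation A := (rep_commutant pi).
Local Notation c x := (impl_pt (p x)).
Local Notation W x := (impl_op (p x)).

Let piM : {morph pi : m n / m * n >-> m * n}%g.
Proof. by move=> m n; apply: unitary_ext; exact: pirep.2. Qed.

Let pi1 : pi 1%g = 1%g.
Proof. exact: morphg1 piM. Qed.

Definition ns_elt (g : G) : N :=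
  if pselect (ns_set N g) is left Ng then Sub g (mem_set Ng) else 1%g.

Lemma ns_eltK g : ns_set N g -> val (ns_elt g) = g.
Proof. by move=> Ng; rewrite /ns_elt; case: pselect. Qed.

Definition section_defect (x y : K) : G := ((c (x * y))^-1 * (c x * c y))%g.
Definition section_rest (g : G) : G := ((c (qmap N g))^-1 * g)%g.

Let kN_mem x y : ns_set N (section_defect x y).
Proof. by apply/qmapP; rewrite qmapM !p_section. Qed.

Let mN_mem g : ns_set N (section_rest g).
Proof. by apply/qmapP; rewrite p_section. Qed.

Definition cocycle_op (x y : K) : unitary H :=
  (W x * W y * (pi (ns_elt (section_defect x y)))^-1 * (W (x * y))^-1)%g.

Let implements_pi n : implements pi (val n) (pi n).
Proof. by move=> m; rewrite -piM ns_conj_val -piM mulgVK. Qed.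

Let implements_W x : implements pi (c x) (W x).
Proof. exact: implP. Qed.

(** The four factors implement c_x, c_y, k^-1 and c_xy^-1, whose product is 1 by the choice of k. *)
Let implements_S x y : implements pi 1%g (cocycle_op x y).
Proof.
have := implementsM (implementsM (implementsM (implements_W x) (implements_W y))
  (implementsV (implements_pi (ns_elt (section_defect x y))))) (implementsV (implements_W (x * y)%g)).
by rewrite ns_eltK // /section_defect invgM invgK mulVKg mulgV.
Qed.

Let pi_W n x : (pi n * W x = W x * pi (ns_conj (c x)^-1 n))%g.
Proof. by rewrite implements_W -ns_conjM mulgV ns_conj1. Qed.

Let piV_W n x : ((pi n)^-1 * W x = W x * (pi (ns_conj (c x)^-1 n))^-1)%g.
Proof.
by apply: (mulgI (pi n)); rewrite mulVKg mulgA pi_W mulgK.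
Qed.

Let c1 : c 1%g = 1%g. Proof. by rewrite p1. Qed.
Let W1 : W 1%g = 1%g. Proof. by rewrite p1. Qed.

Definition rep_aut (x : K) : vnAut A := impl_aut (p x).
Definition rep_cocycle (x y : K) : vnUnitary A := vnu_of pi (cocycle_op x y).

Let sigmaE x y : vnu_unitary (rep_cocycle x y) = cocycle_op x y.
Proof. exact: vnu_ofK. Qed.

Let S1l y : cocycle_op 1%g y = 1%g.
Proof.
rewrite /cocycle_op W1 !mul1g (_ : ns_elt _ = 1%g) ?pi1 ?divg1 ?mulgV //.
by apply: val_inj; rewrite ns_eltK // /section_defect c1 !mul1g mulVg.
Qed.

Let S1r x : cocycle_op x 1%g = 1%g.
Proof.
rewrite /cocycle_op W1 !mulg1 (_ : ns_elt _ = 1%g) ?pi1 ?divg1 ?mulgV //.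
by apply: val_inj; rewrite ns_eltK // /section_defect c1 !mulg1 mulVg.
Qed.

(** Reducing c_r c_s c_t to c_rst in two ways gives k(r, st) k(s, t) = k(rs, t) c_t^-1 k(r, s) c_t
    in N. Applying pi to this is the whole content; the W factors cancel. *)
Let S_cocycle r s t :
  (W r * cocycle_op s t * (W r)^-1 * cocycle_op r (s * t) =
   cocycle_op r s * cocycle_op (r * s) t)%g.
Proof.
have key : (pi (ns_elt (section_defect r (s * t))) * pi (ns_elt (section_defect s t)) =
    pi (ns_elt (section_defect (r * s) t)) *
    pi (ns_conj (c t)^-1 (ns_elt (section_defect r s))))%g.
  rewrite -!piM; congr pi; apply: val_inj.
  rewrite /= !ns_eltK // /section_defect (mulgA r s t).
  by rewrite !(invgM, invgK, mulgA, mulgK, mulgVK).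
have key' : ((pi (ns_elt (section_defect s t)))^-1 *
      (pi (ns_elt (section_defect r (s * t))))^-1 =
    (pi (ns_conj (c t)^-1 (ns_elt (section_defect r s))))^-1 *
      (pi (ns_elt (section_defect (r * s) t)))^-1)%g.
  by rewrite -!invgM key.
rewrite /cocycle_op !(mulgA, mulgK, mulgVK).
rewrite -(mulgA _ (pi (ns_elt (section_defect r s)))^-1%g (W t)) piV_W.
rewrite -(mulgA _ (pi (ns_elt (section_defect s t)))^-1%g) key'.
by rewrite !mulgA.
Qed.

Let alphaE x (a : A) : val (rep_aut x a) = conj_op (W x) (val a).
Proof. by []. Qed.

Let AdE (v : vnUnitary A) (a : A) : val (Ad v a) = conj_op (vnu_unitary v) (val a).
Proof. by []. Qed.

Lemma borel_impl_pt : borel_map (fun x => c x).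
Proof.
apply: (borel_map_comp (g := @impl_pt _ _ _ _ pi)) => //.
by apply: continuous_borel_map; exact: impl_pt_continuous.
Qed.

Lemma borel_impl_op : borel_map (fun x => W x).
Proof.
apply: (borel_map_comp (g := @impl_op _ _ _ _ pi)) => //.
by apply: continuous_borel_map; exact: impl_op_continuous.
Qed.

Let borel_pi (Z : topologicalType) (g : Z -> G) :
  (forall z, ns_set N (g z)) -> borel_map g -> borel_map (fun z => pi (ns_elt (g z))).
Proof.
move=> gN bg; apply: (borel_map_comp (f := fun z => ns_elt (g z)) (g := pi)).
  apply: ns_borel; rewrite (_ : (fun z => _) = g) //.
  by apply/funext => z; rewrite ns_eltK.
by apply: continuous_borel_map; exact: pirep.1.
Qed.

Let borel_fst (Z : topologicalType) (g : K -> Z) : borel_map g ->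
  borel_map (fun xy : K * K => g xy.1).
Proof.
move=> bg; apply: (borel_map_comp (f := fst) (g := g)) => //.
by apply: continuous_borel_map => z; exact: cvg_fst.
Qed.

Let borel_snd (Z : topologicalType) (g : K -> Z) : borel_map g ->
  borel_map (fun xy : K * K => g xy.2).
Proof.
move=> bg; apply: (borel_map_comp (f := snd) (g := g)) => //.
by apply: continuous_borel_map => z; exact: cvg_snd.
Qed.

Let borel_mul (Z : topologicalType) (g : K -> Z) : borel_map g ->
  borel_map (fun xy : K * K => g (xy.1 * xy.2)%g).
Proof.
move=> bg; apply: (borel_map_comp (f := fun xy : K * K => (xy.1 * xy.2)%g) (g := g)) => //.
by apply: continuous_borel_map; exact: mulg_continuous.
Qed.

Lemma twisted_action_of_rep : twisted_action rep_aut rep_cocycle.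
Proof.
have [bG bGP] := second_countable_base sG.
have [xs xsP] := separable_dense_seq sH; have bUP := unitary_countable_base xsP.
split.
- apply: (borel_map_comp (g := @impl_aut _ _ _ _ pi)) => //.
  by apply: continuous_borel_map; exact: impl_aut_continuous.
- apply: vnu_borel; rewrite (_ : (fun z => _) = fun z : K * K => cocycle_op z.1 z.2); last first.
    by apply/funext => z; exact: sigmaE.
  apply: (borel_mulg bUP); last by apply: borel_invg; exact: (borel_mul borel_impl_op).
  apply: (borel_mulg bUP).
    by apply: (borel_mulg bUP); [exact: (borel_fst borel_impl_op)|exact: (borel_snd borel_impl_op)].
  apply: borel_invg; apply: borel_pi => // .
  apply: (borel_mulg bGP); first by apply: borel_invg; exact: (borel_mul borel_impl_pt).
  by apply: (borel_mulg bGP); [exact: (borel_fst borel_impl_pt)|exact: (borel_snd borel_impl_pt)].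
- by move=> a; apply: val_inj; rewrite alphaE W1 conj_op1.
- by move=> s; split; apply: vnu_unitary_inj; rewrite sigmaE ?S1l ?S1r; exact: unitary_ext.
(* sigma(s, t) W_st equals W_s W_t pi(k)^-1, and conjugation by pi(k)^-1 is trivial on the
   commutant. *)
- move=> s t a; apply: val_inj; rewrite AdE !alphaE sigmaE -!conj_opM.
  by rewrite /cocycle_op mulgVK [RHS]conj_opM conj_op_piV.
- move=> r s t; apply: val_inj.
  have := congr1 (@unitary_op R H) (S_cocycle r s t).
  by rewrite -!sigmaE !unitary_opM => h; exact: h.
Qed.

Lemma extension_exterior (rho : G -> unitary H) :
  unitary_representation rho -> (forall n : N, rho (val n) = pi n) ->
  exists beta : K -> vnAut A, vn_action beta /\
    exterior_equivalent rep_aut rep_cocycle beta (fun _ _ => vnu1 A).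
Proof.
move=> [crho rhoM'] rhopi.
have rhoM : {morph rho : x y / x * y >-> x * y}%g.
  by move=> x y; apply: unitary_ext; exact: rhoM'.
have rhoV := morphgV rhoM.
have rho_impl g : implements pi g (rho g).
  by move=> n; rewrite -!rhopi -!rhoM /= mulgVK.
pose beta x : vnAut A := impl_aut (mk_impl (rho_impl (c x))).
(* Ad rho(g) depends only on the class of g, since rho(g) and rho(c_gN) differ by some pi(n), which
   acts trivially. Continuity and multiplicativity of [beta] can thus be checked upstairs on G. *)
have betaE g : beta (qmap N g) = impl_aut (mk_impl (rho_impl g)).
  apply: vna_ext => a; apply: val_inj; rewrite !impl_autE /impl_op /=.
  have -> : rho g = (rho (c (qmap N g)) * pi (ns_elt (section_rest g)))%g.
    by rewrite -rhopi ns_eltK // -rhoM mulVKg.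
  by rewrite conj_opM conj_op_pi.
exists beta; split.
  split.
    apply: continuous_qmap.
    rewrite (_ : beta \o _ = fun g => impl_aut (mk_impl (rho_impl g))).
      exact: (implemented_continuous crho).
    by apply/funext => g; exact: betaE.
  move=> x y a; have [g <-] := qmap_surj x; have [h <-] := qmap_surj y.
  rewrite -qmapM !betaE; apply: val_inj.
  by rewrite !impl_autE /impl_op /= rhoM conj_opM.
have [xs xsP] := separable_dense_seq sH; have bUP := unitary_countable_base xsP.
have nu_impl x : implements pi 1%g (rho (c x) * (W x)^-1)%g.
  by have := implementsM (rho_impl (c x)) (implementsV (implements_W x)); rewrite mulgV.
exists (fun x => vnu_of pi (rho (c x) * (W x)^-1)%g); split.
- apply: vnu_borel.
  rewrite (_ : (fun z => _) = fun z : K => (rho (c z) * (W z)^-1)%g); last first.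
    by apply/funext => z; rewrite vnu_ofK.
  apply: (borel_mulg bUP); last by apply: borel_invg; exact: borel_impl_op.
  apply: (borel_map_comp (g := rho)); first exact: borel_impl_pt.
  exact: continuous_borel_map.
- by move=> x a; apply: val_inj; rewrite AdE alphaE vnu_ofK // -conj_opM mulgVK.
- move=> x y; apply: val_inj.
  pose nu z := (rho (c z) * (W z)^-1)%g.
  (* All W factors cancel, leaving rho(c_x) rho(c_y) pi(k)^-1 rho(c_xy)^-1, which is 1 because pi(k)
     = rho(k). *)
  have h : (1 = nu x * (W x * nu y * (W x)^-1) * cocycle_op x y * (nu (x * y))^-1)%g.
    have rhok : pi (ns_elt (section_defect x y)) =
        ((rho (c (x * y)))^-1 * (rho (c x) * rho (c y)))%g.
      by rewrite -rhopi ns_eltK // !rhoM rhoV.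
    rewrite /nu /cocycle_op rhok !(invgM, invgK, mulgA, mulgK, mulgVK).
    by rewrite mulgV.
  have := congr1 (@unitary_op R H) h.
  have nuE z : nu z = vnu_unitary (vnu_of pi (nu z)) by rewrite (vnu_ofK (nu_impl z)).
  rewrite (nuE x) (nuE y) (nuE (x * y)%g) -sigmaE => h'; exact: h'.
Qed.

Lemma exterior_extension (beta : K -> vnAut A) :
  exterior_equivalent rep_aut rep_cocycle beta (fun _ _ => vnu1 A) ->
  exists rho : G -> unitary H,
    unitary_representation rho /\ (forall n : N, rho (val n) = pi n).
Proof.
move=> [nu [bnu _ nuP]].
have [bG bGP] := second_countable_base sG.
have [xs xsP] := separable_dense_seq sH; have bUP := unitary_countable_base xsP.
pose V x := vnu_unitary (nu x).
have VP x y : (V x * W x * V y * (W x)^-1 * cocycle_op x y = V (x * y))%g.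
  have h : (V x * (W x * V y * (W x)^-1) * cocycle_op x y * (V (x * y))^-1 = 1)%g.
    apply: unitary_ext; rewrite -sigmaE; apply/esym.
    exact: (congr1 val (nuP x y)).
  by apply: (mulIg (V (x * y))^-1%g); rewrite mulgV -h !mulgA.
have V1 : V 1%g = 1%g.
  by have := VP 1%g 1%g; rewrite S1l W1 invg1 !mulg1 -[RHS]mul1g => /mulIg.
(* The corrected family V_x W_x multiplies with defect pi(k), exactly matching the defect k of the
   section c; this makes [rho] multiplicative. *)
have VW x y : (V x * W x * (V y * W y) =
    V (x * y) * W (x * y) * pi (ns_elt (section_defect x y)))%g.
  by rewrite -VP /cocycle_op !(mulgA, mulgK, mulgVK).
have piV n x : (pi n * V x = V x * pi n)%g by exact: vnu_comm.
pose rho g := (V (qmap N g) * W (qmap N g) * pi (ns_elt (section_rest g)))%g.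
have rhoM : {morph rho : g h / g * h >-> g * h}%g.
  move=> g h; rewrite /rho.
  (* With x = gN, y = hN, the N-part of gh is k(x, y) times the N-part of g conjugated by c_y^-1
     times the N-part of h. *)
  have -> : ns_elt (section_rest (g * h)%g) = (ns_elt (section_defect (qmap N g) (qmap N h)) *
      (ns_conj (c (qmap N h))^-1 (ns_elt (section_rest g)) * ns_elt (section_rest h)))%g.
    apply: val_inj; rewrite /= !ns_eltK // /section_rest /section_defect -qmapM.
    by rewrite !(invgM, invgK, mulgA, mulgK, mulgVK).
  set m := ns_elt (section_rest g); set y := qmap N h.
  (* pi(m) passes V_y unchanged, as V_y is in the commutant, and is conjugated by c_y^-1 when it
     passes W_y. *)
  have pim : (pi m * (V y * W y) = V y * W y * pi (ns_conj (c y)^-1 m))%g.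
    by rewrite mulgA piV -mulgA pi_W mulgA.
  rewrite -(mulgA _ (pi m)) (mulgA (pi m)) pim qmapM !piM.
  by rewrite !mulgA -VW !mulgA.
exists rho; split; last first.
  move=> n; have qn : qmap N (val n) = 1%g.
    rewrite -qmap1; apply/esym/qmapP; rewrite invg1 mul1g.
    by have := valP n; rewrite inE.
  rewrite /rho (_ : ns_elt _ = n) ?qn ?V1 ?W1 ?mul1g //.
  by apply: val_inj; rewrite ns_eltK // /section_rest qn c1 invg1 mul1g.
split; last by move=> g h; rewrite rhoM.
apply: (borel_morphism_continuous (group_baire sG lcG) bUP) => //.
have bq (Z : topologicalType) (f : K -> Z) : borel_map f -> borel_map (fun g => f (qmap N g)).
  move=> bf; apply: (borel_map_comp (f := qmap N) (g := f)) => //.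
  by apply: continuous_borel_map; exact: qmap_continuous.
apply: (borel_mulg bUP).
  apply: (borel_mulg bUP); last exact: (bq _ _ borel_impl_op).
  apply: (bq _ V); apply: (borel_map_comp (g := @vnu_unitary _ _ A)) => //.
  by apply: continuous_borel_map; exact: vnu_unitary_continuous.
apply: borel_pi => //; apply: (borel_mulg bGP).
  by apply: borel_invg; exact: (bq _ _ borel_impl_pt).
by apply: continuous_borel_map => g; exact: cvg_id.
Qed.

End TwistedActionOfRep.

Theorem theorem2 (G : topGroupType) (N : normalSubgroup G)
    (R : realType) (H : hilbertType R) (pi : N -> unitary H) :
  hausdorff_space G -> @second_countable G -> locally_compact [set: G] ->
  closed (ns_set N) ->
  separable H ->
  unitary_representation pi ->
  invariant_rep pi ->
  exists (alpha : quotient_group N -> vnAut (rep_commutant pi))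
         (sigma : quotient_group N -> quotient_group N ->
                  vnUnitary (rep_commutant pi)),
    twisted_action alpha sigma /\
    ((exists rho : G -> unitary H,
        unitary_representation rho /\ (forall n : N, rho (val n) = pi n)) <->
     (exists beta : quotient_group N -> vnAut (rep_commutant pi),
        vn_action beta /\
        exterior_equivalent alpha sigma beta
          (fun _ _ => vnu1 (rep_commutant pi)))).
Proof.
move=> hG sG lcG cN sH pirep piinv.
have [p [bp pK p1]] := implementing_section hG sG lcG sH pirep piinv cN.
exists (rep_aut p), (rep_cocycle p); split.
  exact: (twisted_action_of_rep sG sH pirep bp pK p1).
split=> [[rho [rhorep rhopi]]|[beta [_ ext]]].
- exact: (extension_exterior sH pirep bp pK rhorep rhopi).
- exact: (exterior_extension sG lcG sH pirep bp pK p1 ext).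
Qed.
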